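(* Let $R$ be an $\omega$-categorical ring (associative, not necessarily commutative, not necessarily with $1$) whose theory has NIP. Then $R$ is nilpotent-by-finite, i.e. $R$ has an ideal of finite index which is nilpotent.
   Context: A structure in a countable language is $\omega$-categorical if its complete theory has, up to isomorphism, exactly one countable model (here $R$ is considered as a first-order structure in a countable language containing the ring operations). A ring $I$ is nilpotent if there is $n$ with $r_1\cdots r_n=0$ for all $r_1,\dots,r_n\in I$. A theory $T$ has NIP if there is no formula $\varphi(x,y)$ and sequence $(a_i)_{i<\omega}$ in a model of $T$ such that for every $w\subseteq\omega$ there is $b_w$ with $\models\varphi(a_i,b_w)$ iff $i\in w$. *)

(* Defs.v *)
From HB Require Import structures.
From mathcomp Require Import all_boot all_algebra.
From mathcomp Require Import boolp classical_sets cardinality.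

Set Implicit Arguments.
Unset Strict Implicit.
Unset Printing Implicit Defensive.

Import GRing.Theory.

Local Open Scope classical_set_scope.
Local Open Scope ring_scope.

(* Associative rings, not necessarily commutative and not necessarily unital.
   MathComp's ring structures all include a unit element. *)
HB.mixin Record Zmodule_isRng R of GRing.Zmodule R := {
  rmul : R -> R -> R;
  rmulA : associative rmul;
  rmulDl : left_distributive rmul +%R;
  rmulDr : right_distributive rmul +%R
}.

#[short(type="rngType")]
HB.structure Definition Rng := {R of GRing.Zmodule R & Zmodule_isRng R}.

Record is_ideal (R : rngType) (I : set R) : Prop := IsIdeal {
  ideal0 : I 0;
  idealB : forall x y, I x -> I y -> I (x - y);
  idealMl : forall r x, I x -> I (rmul r x);
  idealMr : forall r x, I x -> I (rmul x r)
}.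

Definition ideal_coset (R : rngType) (I : set R) (x : R) : set R :=
  [set y | I (y - x)].

Definition finite_index (R : rngType) (I : set R) : Prop :=
  finite_set (range (ideal_coset I)).

(* There being no unit, a product has at least one factor:
   foldl rmul r s is the product of the size s + 1 elements of r :: s. *)
Definition nilpotent_ideal (R : rngType) (I : set R) : Prop :=
  exists n, forall (r : R) (s : seq R), size s = n ->
    (forall x, x \in r :: s -> I x) -> foldl rmul r s = 0.

Definition nilpotent_by_finite (R : rngType) : Prop :=
  exists I : set R, [/\ is_ideal I, finite_index I & nilpotent_ideal I].

Record language := Language {
  funs : Type;
  rels : Type;
  fun_arity : funs -> nat;
  rel_arity : rels -> nat
}.

Definition countable_language (L : language) : Prop :=
  countable [set: funs L] /\ countable [set: rels L].

(* Terms and formulas with free variables in V; the variable bound by Forall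
   is None : option V. *)
Inductive term (L : language) (V : Type) : Type :=
| Var of V
| App (f : funs L) of ('I_(fun_arity f) -> term L V).

Inductive formula (L : language) (V : Type) : Type :=
| Falsum
| Equal of term L V & term L V
| Rel (r : rels L) of ('I_(rel_arity r) -> term L V)
| Implies of formula L V & formula L V
| Forall of formula L (option V).

Definition sentence (L : language) := formula L void.
Definition theory (L : language) := set (sentence L).

Record interpretation (L : language) (T : Type) := Interpretation {
  fun_int : forall f : funs L, ('I_(fun_arity f) -> T) -> T;
  rel_int : forall r : rels L, ('I_(rel_arity r) -> T) -> Prop
}.

Record structure (L : language) := Structure {
  carrier :> Type;
  interp : interpretation L carrier
}.

Fixpoint eval (L : language) (M : structure L) (V : Type) (e : V -> M)
    (t : term L V) : M :=
  match t with
  | Var v => e v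
  | App f ts => fun_int (interp M) (fun i => eval e (ts i))
  end.

Definition env_cons (T V : Type) (x : T) (e : V -> T) (v : option V) : T :=
  if v is Some u then e u else x.

Fixpoint sat (L : language) (M : structure L) (V : Type) (e : V -> M)
    (phi : formula L V) : Prop :=
  match phi with
  | Falsum => False
  | Equal t u => eval e t = eval e u
  | Rel r ts => rel_int (interp M) (fun i => eval e (ts i))
  | Implies psi chi => sat e psi -> sat e chi
  | Forall psi => forall x : M, sat (env_cons x e) psi
  end.

Definition holds (L : language) (M : structure L) (phi : sentence L) : Prop :=
  sat (fun v : void => match v return M with end) phi.

Definition models (L : language) (M : structure L) (T : theory L) : Prop :=
  forall phi, T phi -> holds M phi.

Definition Th (L : language) (M : structure L) : theory L :=
  [set phi | holds M phi].

Definition isomorphic (L : language) (M N : structure L) : Prop :=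
  exists h : M -> N, [/\ bijective h,
    forall (f : funs L) (a : 'I_(fun_arity f) -> M),
      h (fun_int (interp M) a) = fun_int (interp N) (h \o a) &
    forall (r : rels L) (a : 'I_(rel_arity r) -> M),
      rel_int (interp M) a <-> rel_int (interp N) (h \o a)].

(* "countable" is "finite or countably infinite", so finite structures are
   omega-categorical. *)
Definition omega_categorical (L : language) (M : structure L) : Prop :=
  exists N : structure L,
    [/\ countable [set: N], models N (Th M) &
      forall N' : structure L,
        countable [set: N'] -> models N' (Th M) -> isomorphic N N'].

Definition env_pair (T V W : Type) (a : V -> T) (b : W -> T) (v : V + W) : T :=
  match v with inl i => a i | inr j => b j end.

(* In phi(x, y), x is a p-tuple and y a q-tuple of variables. *)
Definition NIP (L : language) (T : theory L) : Prop :=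
  ~ exists (p q : nat) (phi : formula L ('I_p + 'I_q)) (M : structure L)
      (a : nat -> 'I_p -> M),
    models M T /\
    forall w : set nat, exists b : 'I_q -> M,
      forall i : nat, sat (env_pair (a i) b) phi <-> w i.

Inductive ring_op := OpZero | OpOpp | OpAdd | OpMul.

Definition ring_op_arity (o : ring_op) : nat :=
  match o with OpZero => 0 | OpOpp => 1 | OpAdd => 2 | OpMul => 2 end%N.

(* A language containing the ring operations: L consists of its remaining
   symbols. *)
Definition ring_language (L : language) : language :=
  @Language (ring_op + funs L) (rels L)
    (fun f => match f with inl o => ring_op_arity o | inr g => fun_arity g end)
    (@rel_arity L).

Definition ring_op_int (R : rngType) (o : ring_op) :
    ('I_(ring_op_arity o) -> R) -> R :=
  match o return ('I_(ring_op_arity o) -> R) -> R with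
  | OpZero => fun _ => 0
  | OpOpp => fun a => - a ord0
  | OpAdd => fun a => a ord0 + a ord_max
  | OpMul => fun a => rmul (a ord0) (a ord_max)
  end.

(* R with its ring operations and with E interpreting the other symbols. *)
Definition ring_structure (L : language) (R : rngType)
    (E : interpretation L R) : structure (ring_language L) :=
  @Structure (ring_language L) R
    (@Interpretation (ring_language L) R
      (fun f => match f return
                  ('I_(@fun_arity (ring_language L) f) -> R) -> R with
                | inl o => @ring_op_int R o
                | inr g => fun_int E (f := g)
                end)
      (fun r => rel_int E (r := r))).

(* Main.v *)
(** Call x square-zero modulo an ideal I if the ideal generated by x squares
    into I.  If u_0, ..., u_(k+1) are square-zero modulo I and their product is
    not in I, then for x_i = u_0 .. u_i and y_i = u_(i+2) .. u_(k+1) the product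
    x_i u_(j+1) y_i lies in I exactly when i <> j, so the sums of the u_(j+1)
    shatter the k pairs (x_i, y_i) by the formula "x t y is not in I".  By NIP
    the square-zero elements therefore span a nilpotent ideal modulo I.  By
    omega-categoricity (Ryll-Nardzewski) there are only finitely many definable
    subsets, so that this span is definable, and R has a maximal definable
    nilpotent ideal I; the quotient Q = R / I is semiprime.

    Again by Ryll-Nardzewski, x^n is idempotent for all x and a fixed n.  With a
    theorem of Levitzki, every nonzero left ideal of Q contains a nonzero
    idempotent, while the same NIP pattern bounds the number of orthogonal
    idempotents.  A maximal family e_1, ..., e_k of these has sum 1, and each
    e_i Q e_i is a division ring of bounded exponent, which is finite; each
    e_i Q e_j embeds into e_i Q e_i, so Q is finite. *)

From HB Require Import structures.
From mathcomp Require Import all_boot all_algebra.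
From mathcomp Require Import boolp classical_sets cardinality filter.
Require Import Defs.

Set Implicit Arguments.
Unset Strict Implicit.
Unset Printing Implicit Defensive.

Local Open Scope classical_set_scope.

(** * Formulas: renaming of variables and finite support *)

Definition fnot L V (phi : formula L V) : formula L V :=
  Implies phi (@Falsum L V).

Lemma sat_fnot L (M : structure L) V (e : V -> M) (phi : formula L V) :
  sat e (fnot phi) <-> ~ sat e phi.
Proof. by []. Qed.

Fixpoint term_rename L V W (f : V -> W) (t : term L V) : term L W :=
  match t with
  | Var v => @Var L W (f v)
  | App g ts => @App L W g (fun i => term_rename f (ts i))
  end.

Fixpoint rename L V W (f : V -> W) (phi : formula L V) : formula L W :=
  match phi with
  | Falsum => @Falsum L W
  | Equal t u => Equal (term_rename f t) (term_rename f u)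
  | Rel r ts => @Rel L W r (fun i => term_rename f (ts i))
  | Implies psi chi => Implies (rename f psi) (rename f chi)
  | Forall psi => Forall (rename (omap f) psi)
  end.

Lemma eval_rename L (M : structure L) V W (f : V -> W) (e : W -> M)
    (t : term L V) : eval e (term_rename f t) = eval (e \o f) t.
Proof.
elim: t => //= g ts IH; congr (fun_int _ _).
by apply/funext => i; rewrite IH.
Qed.

Lemma env_cons_omap T V W (f : V -> W) (x : T) (e : W -> T) :
  env_cons x e \o omap f = env_cons x (e \o f).
Proof. by apply/funext => -[]. Qed.

Lemma sat_rename L (M : structure L) V (phi : formula L V) :
  forall W (f : V -> W) (e : W -> M), sat e (rename f phi) <-> sat (e \o f) phi.
Proof.
elim: phi => {V} [V|V t u|V r ts|V psi IHpsi chi IHchi|V psi IH] W f e //=.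
- by rewrite !eval_rename.
- have -> // : (fun i => eval e (term_rename f (ts i)))
             = (fun i => eval (e \o f) (ts i)).
  by apply/funext => i; rewrite eval_rename.
- by split=> h /IHpsi /h /IHchi.
- by split=> h x; have := h x; rewrite -env_cons_omap IH.
Qed.

Lemma eval_support L V (t : term L V) : exists2 S : set V, finite_set S &
  forall (M : structure L) (e e' : V -> M),
    (forall v, S v -> e v = e' v) -> eval e t = eval e' t.
Proof.
elim: t => [v|g ts IH]; first by exists [set v] => // M e e' /=; apply.
have /choice[S SP] i : exists S : set V, finite_set S /\
    forall (M : structure L) (e e' : V -> M),
    (forall v, S v -> e v = e' v) -> eval e (ts i) = eval e' (ts i).
  by have [S] := IH i; exists S.
exists (\bigcup_i S i).
  by apply: bigcup_finite => [|i _]; [exact: finite_finset|case: (SP i)].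
move=> M e e' ee' /=; congr (fun_int _ _); apply/funext => i.
by apply: (SP i).2 => v Sv; apply: ee'; exists i.
Qed.

(** A formula mentions finitely many variables even when [V] is infinite, which leaves room for
    fresh coordinates later on. Under a quantifier the preimage along [Some] drops the bound
    variable from the support. *)
Lemma sat_support L V (phi : formula L V) : exists2 S : set V, finite_set S &
  forall (M : structure L) (e e' : V -> M),
    (forall v, S v -> e v = e' v) -> sat e phi -> sat e' phi.
Proof.
elim: phi => {V} [V|V t u|V r ts|V psi [S fS SP] chi [S' fS' SP']|V psi [S fS SP]].
- by exists set0.
- have [S fS SP] := eval_support t; have [S' fS' SP'] := eval_support u.
  exists (S `|` S'); first by rewrite finite_setU.
  move=> M e e' ee' /= tu; rewrite -(SP _ e) => [|v Sv]; last by apply: ee'; left.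
  by rewrite tu; apply: SP' => v Sv; apply: ee'; right.
- have /choice[S SP] i : exists S : set V, finite_set S /\
    forall (M : structure L) (e e' : V -> M),
    (forall v, S v -> e v = e' v) -> eval e (ts i) = eval e' (ts i).
    by have [S] := eval_support (ts i); exists S.
  exists (\bigcup_i S i).
    by apply: bigcup_finite => [|i _]; [exact: finite_finset|case: (SP i)].
  move=> M e e' ee' /=.
  have -> // : (fun i => eval e (ts i)) = (fun i => eval e' (ts i)).
  by apply/funext => i; apply: (SP i).2 => v Sv; apply: ee'; exists i.
- exists (S `|` S'); first by rewrite finite_setU.
  move=> M e e' ee' /= h /(SP _ e' e) he.
  apply: (SP' _ e e') => [v Sv|]; first by apply: ee'; right.
  by apply/h/he => v Sv; rewrite ee'//; left.
- exists (Some @^-1` S); first by apply: finite_preimage => // ? ? _ _ [].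
  by move=> M e e' ee' /= h x; apply: SP (h x) => -[v|]//= Sv; apply: ee'.
Qed.

(** * Definable sets and their closure properties *)

Definition definable L (M : structure L) V (X : set (V -> M)) : Prop :=
  exists phi : formula L V, forall e, sat e phi <-> X e.

Section Definability.
Context (L : language) (M : structure L).
Implicit Types V W : Type.

Lemma definable_ext V (X Y : set (V -> M)) :
  (forall e, X e <-> Y e) -> definable X -> definable Y.
Proof. by move=> XY [phi phiP]; exists phi => e; rewrite phiP. Qed.

Lemma definable_imp V (X Y : set (V -> M)) :
  definable X -> definable Y -> definable [set e | X e -> Y e].
Proof.
move=> [phi phiP] [psi psiP]; exists (Implies phi psi) => e /=.
by rewrite phiP psiP.
Qed.

Lemma definable_setC V (X : set (V -> M)) : definable X -> definable (~` X).
Proof. by move=> [phi phiP]; exists (fnot phi) => e; rewrite sat_fnot phiP. Qed.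

Lemma definable_and V (X Y : set (V -> M)) :
  definable X -> definable Y -> definable [set e | X e /\ Y e].
Proof.
move=> dX dY; apply: definable_ext (definable_setC (definable_imp dX (definable_setC dY))).
by move=> e /=; split=> [/not_implyP[? /contrapT]|[? ?]] //; apply/not_implyP; split=> // /(_ _).
Qed.

Lemma definable_forall V (X : set (option V -> M)) :
  definable X -> definable [set e : V -> M | forall x, X (env_cons x e)].
Proof.
move=> [phi phiP]; exists (Forall phi) => e /=.
by split=> h x; apply/phiP.
Qed.

Lemma definable_exists V (X : set (option V -> M)) :
  definable X -> definable [set e : V -> M | exists x, X (env_cons x e)].
Proof.
move=> /definable_setC/definable_forall/definable_setC; apply: definable_ext => e /=.
by split=> [/existsNP[x /contrapT] ?|[x ?] h]; [exists x|apply: (h x)].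
Qed.

Lemma definable_rename V W (f : V -> W) (X : set (V -> M)) :
  definable X -> definable [set e : W -> M | X (e \o f)].
Proof. by move=> [phi phiP]; exists (rename f phi) => e; rewrite sat_rename phiP. Qed.

Definition definable_fun V (f : (V -> M) -> M) : Prop :=
  exists t : term L V, forall e, eval e t = f e.

Lemma definable_eq V (f g : (V -> M) -> M) :
  definable_fun f -> definable_fun g -> definable [set e | f e = g e].
Proof.
by move=> [t tP] [u uP]; exists (Equal t u) => e /=; rewrite tP uP.
Qed.

Lemma definable_fun_var V (v : V) : definable_fun (fun e => e v).
Proof. by exists (@Var L V v). Qed.

Lemma definable_fun_rename V W (r : V -> W) (f : (V -> M) -> M) :
  definable_fun f -> definable_fun (fun e => f (e \o r)).
Proof.
by move=> [t tP]; exists (term_rename r t) => e; rewrite eval_rename tP.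
Qed.

Lemma definable_true V : definable [set: V -> M].
Proof. by exists (Implies (@Falsum L V) (@Falsum L V)) => e; split=> // _ []. Qed.

Lemma definable_forall_ord V (n : nat) (X : 'I_n -> set (V -> M)) :
  (forall i, definable (X i)) -> definable [set e | forall i, X i e].
Proof.
elim: n X => [|n IH] X dX.
  by apply: definable_ext (definable_true V) => e /=; split=> // _ [].
have := definable_and (dX ord0) (IH _ (fun i => dX (lift ord0 i))).
apply: definable_ext => e /=; split=> [[X0 XS] i|XS]; last by split.
by have [j ->|->] := unliftP ord0 i; [exact: XS|].
Qed.

Definition update V (P : pred V) (e : V -> M) (x : M) (v : V) : M :=
  if P v then x else e v.

(** Quantifies over free variables of [V] in place: all those in [P] are renamed to the bound
    variable [None]. *)
Lemma definable_update V (P : pred V) (X : set (V -> M)) :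
  definable X -> definable [set e | exists x, X (update P e x)].
Proof.
move=> /(definable_rename (fun v : V => if P v then None else Some v)).
move=> /definable_exists; apply: definable_ext => e /=.
have eqe x : env_cons x e \o (fun v => if P v then None else Some v)
           = update P e x by apply/funext => v; rewrite /update /=; case: ifP.
by split=> -[x]; [rewrite eqe|rewrite -eqe]; exists x.
Qed.

Lemma definable_exists_below W (k : nat) (X : set (nat + W -> M)) :
  definable X -> definable [set e : nat + W -> M | exists2 e' : nat + W -> M,
    X e' & forall v, (if v is inl j then k <= j else true) -> e' v = e v].
Proof.
elim: k => [|k IH] dX.
  apply: definable_ext dX => e /=; split=> [Xe|[e' Xe' ee']]; first by exists e.
  by have <- : e' = e by apply/funext => -[j|w]; exact: ee'.
pose P (v : nat + W) := if v is inl j then j == k else false.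
have := definable_update P (IH dX); apply: definable_ext => e /=; split.
  move=> [x [e' Xe' ee']]; exists e' => // -[j kj|w _]; rewrite ee' //=.
    by rewrite /update /= gtn_eqF.
  exact: ltnW.
move=> [e' Xe' ee']; exists (e' (inl k)); exists e' => // -[j kj|w _].
  rewrite /update /=; case: eqVneq => [->//|jk]; apply: ee'.
  by rewrite ltn_neqAle eq_sym jk.
exact: ee'.
Qed.

(** Omitting a type needs that the values taken on a forcing condition by a tuple [f] of coordinates
    form a definable set. The variables [inr i] hold the tuple, and the coordinates are quantified
    away. *)
Lemma definable_projection n (f : 'I_n.+1 -> nat) m (X : set (nat -> M)) :
  (forall e e', (forall j, j < m -> e j = e' j) -> X e -> X e') ->
  definable X ->
  definable [set a : 'I_n.+1 -> M | exists2 e, X e & e \o f = a].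
Proof.
move=> mX dX.
pose Y : set (nat + 'I_n.+1 -> M) :=
  [set e : nat + 'I_n.+1 -> M | X (e \o inl) /\ forall i, e (inl (f i)) = e (inr i)].
have dY : definable Y.
  apply: definable_and; first exact: definable_rename.
  by apply: definable_forall_ord => i; apply: definable_eq; exact: definable_fun_var.
(* All coordinates that [X] or [f] reads lie below [k]; the values at the others do not matter, so
   these may all be renamed to [ord0]. *)
pose k := maxn m (\max_i f i).+1.
have := definable_rename
  (fun v : nat + 'I_n.+1 => if v is inr i then i else ord0)
  (definable_exists_below k dY).
apply: definable_ext => a /=; split.
  move=> [e [Xe ef] ea]; exists (e \o inl) => //.
  by apply/funext => i /=; rewrite ef ea.
move=> [e Xe <-].
exists (fun v => match v with inl j => if j < k then e j else e (f ord0)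
                            | inr i => e (f i) end).
  split=> [|i].
    apply: mX Xe => j jm /=; rewrite ifT //.
    by rewrite leq_max jm.
  by rewrite ifT // leq_max ltnS leq_bigmax orbT.
by move=> [j|i] //= kj; rewrite ltnNge kj.
Qed.
End Definability.

Lemma ultra_setC T (U : set_system T) (A : set T) :
  UltraFilter U -> U (~` A) <-> ~ U A.
Proof.
move=> UU; split=> [UC UA|]; last by have [] := in_ultra_setVsetC A UU.
by apply: (@filter_not_empty _ U); rewrite -(setICr A); exact: filterI.
Qed.

Lemma ultra_imp T (U : set_system T) (A B : set T) :
  UltraFilter U -> U [set x | A x -> B x] <-> (U A -> U B).
Proof.
move=> UU; split=> [UAB UA|UAB]; first by apply: filterS2 UAB UA => x; apply.
have [UA|UA] := in_ultra_setVsetC A UU.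
  by apply: filterS (UAB UA) => x Bx _.
by apply: filterS UA => x /= nAx Ax.
Qed.

(** * Reduced powers along a family of functions *)

(* With J := I -> M and g := id this is the ultrapower of M; with J countable
   it is a countable elementary substructure of the ultrapower. *)
Section Los.
Context (L : language) (M : structure L) (I J : Type) (U : set_system I).
Context (UU : UltraFilter U) (g : J -> I -> M).

(** The closure under witnesses needed in the quantifier step of Los's theorem: choice provides it
    for all functions, genericity for the countable family of coordinates. *)
Definition henkin : Prop := forall V (psi : formula L (option V)) (a : V -> J),
  U [set i | exists x, sat (env_cons x (fun v => g (a v) i)) psi] ->
  exists j, U [set i | sat (env_cons (g j i) (fun v => g (a v) i)) psi].

Definition germ_class (j : J) : set J := [set k | U [set i | g j i = g k i]].
Definition germ : Type := {A : set J | exists j, A = germ_class j}.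
Definition germ_of (j : J) : germ := exist _ (germ_class j) (ex_intro _ j erefl).
Definition germ_repr (q : germ) : J := projT1 (cid (proj2_sig q)).

Lemma germ_eq (q q' : germ) : proj1_sig q = proj1_sig q' -> q = q'.
Proof.
by case: q q' => [A hA] [B hB] /= AB; subst B; rewrite (Prop_irrelevance hA hB).
Qed.

Lemma germ_reprK q : germ_of (germ_repr q) = q.
Proof.
by apply: germ_eq; rewrite /= /germ_repr; case: cid => j /= ->.
Qed.

Lemma germ_ofP j k : germ_of j = germ_of k <-> U [set i | g j i = g k i].
Proof.
split=> [[jk]|Ujk].
  have : germ_class j k by rewrite jk; exact: filterS filterT.
  by [].
apply: germ_eq; apply/seteqP; split=> l /= Ul.
  by apply: filterS2 Ujk Ul => i /= <-.
by apply: filterS2 Ujk Ul => i /= ->.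
Qed.

Hypothesis gU : henkin.

(** Closure under function symbols is the [henkin] condition for the formula [x = f(a)]. *)
Lemma germ_fun_ex (f : funs L) (a : 'I_(fun_arity f) -> germ) :
  exists j, U [set i | g j i = fun_int (interp M) (fun l => g (germ_repr (a l)) i)].
Proof.
have [|j Uj] := @gU _ (Equal (@Var L _ None)
    (@App L _ f (fun l => @Var L _ (Some l)))) (germ_repr \o a).
  apply: filterS filterT => i _ /=.
  by exists (fun_int (interp M) (fun l => g (germ_repr (a l)) i)).
by exists j.
Qed.

Definition germ_structure : structure L :=
  @Structure L germ (@Interpretation L germ
    (fun f a => germ_of (projT1 (cid (germ_fun_ex a))))
    (fun r a => U [set i | rel_int (interp M) (fun l => g (germ_repr (a l)) i)])).

(** The value of a term is a germ with no preferred index, hence the comparison with an arbitrary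
    [j]. *)
Lemma los_eval V (t : term L V) (a : V -> J) (j : J) :
  eval (M := germ_structure) (germ_of \o a) t = germ_of j <->
  U [set i | eval (fun v => g (a v) i) t = g j i].
Proof.
elim: t j => [v|f ts IH] j; first exact: germ_ofP.
rewrite /=; case: cid => c /= Uc; rewrite germ_ofP.
have Ub : U [set i | (fun l => eval (fun v => g (a v) i) (ts l)) =
    (fun l => g (germ_repr (eval (M := germ_structure) (germ_of \o a) (ts l))) i)].
  have : U [set i | forall l, eval (fun v => g (a v) i) (ts l) =
      g (germ_repr (eval (M := germ_structure) (germ_of \o a) (ts l))) i].
    by apply: filter_forall => l; apply/(IH l); rewrite germ_reprK.
  by apply: filterS => i h; apply/funext.
split=> Uj.
  by apply: filterS3 Uj Uc Ub => i /= <- -> ->.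
by apply: filterS3 Uj Uc Ub => i /= <- -> ->.
Qed.

Lemma los_sat V (phi : formula L V) (a : V -> J) :
  sat (M := germ_structure) (germ_of \o a) phi <->
  U [set i | sat (fun v => g (a v) i) phi].
Proof.
elim: phi a => {V} [V|V t u|V r ts|V psi IHpsi chi IHchi|V psi IH] a /=.
- by split=> // /filter_not_empty.
- set q := eval _ u; have /esym q1 := germ_reprK q.
  have /los_eval Uu := q1; rewrite q1 los_eval.
  by split=> Ut; apply: filterS2 Ut Uu => i /= -> ->.
- have Ub : U [set i | (fun l => eval (fun v => g (a v) i) (ts l)) =
    (fun l => g (germ_repr (eval (M := germ_structure) (germ_of \o a) (ts l))) i)].
    have : U [set i | forall l, eval (fun v => g (a v) i) (ts l) =
        g (germ_repr (eval (M := germ_structure) (germ_of \o a) (ts l))) i].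
      by apply: filter_forall => l; apply/los_eval; rewrite germ_reprK.
    by apply: filterS => i h; apply/funext.
  by split=> Ur; apply: filterS2 Ur Ub => i /=; [move=> + ->|move=> + <-].
- by rewrite IHpsi IHchi -ultra_imp.
- have envE x : env_cons (germ_of x) (germ_of \o a) = germ_of \o env_cons x a.
    by apply/funext => -[].
  have envE' x i : (fun v => g (env_cons x a v) i)
      = env_cons (g x i) (fun v => g (a v) i) by apply/funext => -[].
  split=> [h|Upsi q].
    (* If the matrix can be refuted on a set in [U], then [henkin] names a single germ that refutes
       it. *)
    apply: contrapT => nU'; have nU := (ultra_setC _ UU).2 nU'.
    have [|j Uj] := @gU _ (fnot psi) a.
      by apply: filterS nU => i /= /existsNP.
    have := h (germ_of j); rewrite envE IH => Uj'.
    apply: (@filter_not_empty _ U); apply: filterS2 Uj Uj' => i /=.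
    by rewrite envE'.
  rewrite -(germ_reprK q) envE IH; apply: filterS Upsi => i /= h.
  by rewrite envE'.
Qed.

Lemma germ_structure_models : models germ_structure (Th M).
Proof.
move=> phi; rewrite /Th /holds /=.
set e := (X in sat X phi) => Mphi; set e' := (X in sat X phi).
have -> : e' = germ_of \o (fun v : void => match v with end) by apply/funext => -[].
apply/los_sat; apply: filterS filterT => i _ /=.
by rewrite (_ : (fun v => _) = e) //; apply/funext => -[].
Qed.

End Los.

(** * A finitary form of NIP *)

(** Compactness through an ultrapower: if arbitrarily long patterns exist, a nonprincipal
    ultrafilter on [nat] glues them into an infinite one, since entry [i] behaves correctly at every
    coordinate [k] above [i]. *)
Lemma NIP_finite L (M : structure L) p q (X : set ('I_p + 'I_q -> M)) :
  NIP (Th M) -> definable X ->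
  exists k : nat, ~ exists a : nat -> 'I_p -> M, forall w : set nat,
    exists b : 'I_q -> M, forall i, i < k -> X (env_pair (a i) b) <-> w i.
Proof.
move=> nip [phi phiP]; apply: contrapT => /forallNP h; apply: nip.
have {h}/choice[a ah] : forall k, exists a : nat -> 'I_p -> M,
    forall w : set nat, exists b : 'I_q -> M,
    forall i, i < k -> X (env_pair (a i) b) <-> w i by move=> k; exact: contrapT (h k).
have [U [UU Usub]] := @ultraFilterLemma nat \oo _.
pose g (f : nat -> M) := f.
have gU : henkin U g.
  move=> V psi f Uf.
  have [x0 _] : exists x : M, True.
    by have [i [x _]] := filter_ex Uf; exists x.
  have /choice[x xP] i : exists x, (exists x, sat (env_cons x (fun v => g (f v) i)) psi) ->
      sat (env_cons x (fun v => g (f v) i)) psi.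
    by case: (pselect (exists x, sat (env_cons x (fun v => g (f v) i)) psi)) => [[x]|n];
      [exists x|exists x0].
  by exists x; apply: filterS Uf => i /xP.
exists p, q, phi, (germ_structure UU gU).
exists (fun i l => germ_of U g (fun k => a k i l)); split.
  exact: germ_structure_models.
move=> w.
have /choice[b bP] k : exists b : 'I_q -> M, forall i, i < k ->
    X (env_pair (a k i) b) <-> w i by exact: ah.
exists (fun l => germ_of U g (fun k => b k l)) => i.
pose c (v : 'I_p + 'I_q) k := env_pair (a k i) (b k) v.
have -> : env_pair (fun l => germ_of U g (fun k => a k i l))
    (fun l => germ_of U g (fun k => b k l)) = germ_of U g \o c.
  by apply/funext => -[].
rewrite (los_sat UU gU).
have Ui : U [set k | (i < k)%N] by apply: Usub; exists i.+1.
split=> [Uphi|wi].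
  have [k [/phiP Xk ik]] := filter_ex (filterI Uphi Ui).
  exact: (bP k i ik).1 Xk.
apply: filterS Ui => k ik; apply/phiP; exact: (bP k i ik).2 wi.
Qed.

(** * The Ryll-Nardzewski theorem *)

Section FormulaCode.
Context (L : language) (codef : funs L -> nat) (coder : rels L -> nat).
Hypotheses (codef_inj : injective codef) (coder_inj : injective coder).

Fixpoint term_code V (c : V -> nat) (t : term L V) : GenTree.tree nat :=
  match t with
  | Var v => GenTree.Leaf (c v)
  | App f ts => GenTree.Node (codef f)
      [seq term_code c (ts i) | i <- enum 'I_(fun_arity f)]
  end.

(** Finite trees labelled by numbers are countable. Under a quantifier the bound variable gets code
    0 and the others move up by one, which keeps the numbering of variables injective. *)
Fixpoint formula_code V (c : V -> nat) (phi : formula L V) : GenTree.tree nat :=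
  match phi with
  | Falsum => GenTree.Node 0 [::]
  | Equal t u => GenTree.Node 1 [:: term_code c t; term_code c u]
  | Rel r ts => GenTree.Node 2 (GenTree.Leaf (coder r) ::
      [seq term_code c (ts i) | i <- enum 'I_(rel_arity r)])
  | Implies psi chi => GenTree.Node 3 [:: formula_code c psi; formula_code c chi]
  | Forall psi => GenTree.Node 4
      [:: formula_code (fun v => if v is Some u then (c u).+1 else 0) psi]
  end.

Lemma eq_map_enum n T (f g : 'I_n -> T) :
  [seq f i | i <- enum 'I_n] = [seq g i | i <- enum 'I_n] -> f =1 g.
Proof.
by move=> /eq_in_map fg i; apply: fg; rewrite mem_enum.
Qed.

Lemma term_code_inj V (c : V -> nat) : injective c -> injective (term_code c).
Proof.
move=> c_inj; elim=> [v|f ts IH] [w|f' ts'] //= [].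
  by move=> /c_inj ->.
move=> /codef_inj ff'; subst f' => /eq_map_enum tt'.
by congr (App _); apply/funext => i; apply/IH/tt'.
Qed.

Lemma formula_code_inj V (c : V -> nat) :
  injective c -> injective (formula_code c).
Proof.
move=> c_inj phi; elim: phi c c_inj => {V}
  [V|V t u|V r ts|V psi IHpsi chi IHchi|V psi IH] c c_inj
  [|t' u'|r' ts'|psi' chi'|psi'] //= [].
- by move=> /(term_code_inj c_inj) -> /(term_code_inj c_inj) ->.
- move=> /coder_inj rr'; subst r' => /eq_map_enum tt'; congr (Rel _).
  by apply/funext => i; apply: (term_code_inj c_inj); exact: tt'.
- by move=> /(IHpsi _ c_inj) -> /(IHchi _ c_inj) ->.
- move=> h; congr Forall; apply: IH h.
  by move=> [v|] [w|] // [] /c_inj ->.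
Qed.

End FormulaCode.

(** The variables are [option nat] because the witness requirements to be enumerated are formulas
    with one bound variable over the coordinates. *)
Lemma formula_countable L : countable_language L ->
  exists code : formula L (option nat) -> nat, injective code.
Proof.
move=> [/countable_injP[cf /in2TT cf_inj] /countable_injP[cr /in2TT cr_inj]].
exists (choice.pickle \o formula_code cf cr (fun v => if v is Some n then n.+1 else 0)).
apply: inj_comp; first exact: pcan_inj choice.pickleK.
by apply: formula_code_inj => // -[v|] [w|] // [->].
Qed.

(* Sets of assignments of M are the forcing conditions; F is the part of the
   generic ultrafilter that is prescribed in advance. *)
Section Generic.
Context (L : language) (M : structure L) (F : set_system (nat -> M)).
Context (FF : ProperFilter F).
Implicit Types X Y : set (nat -> M).

Definition depends_below (m : nat) X : Prop :=
  forall e e', (forall j, j < m -> e j = e' j) -> X e -> X e'.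

Definition condition X : Prop := definable X /\ exists m, depends_below m X.

Definition positive X : Prop := forall A, F A -> A `&` X !=set0.

(** The dense families are met one by one along a descending sequence of conditions. As each of
    these is positive, the sequence and [F] generate a proper filter, and any ultrafilter above it
    will do. *)
Lemma rasiowa_sikorski (D : nat -> set (set (nat -> M))) :
  (forall k X, condition X -> positive X ->
     exists Y, [/\ Y `<=` X, condition Y, positive Y & D k Y]) ->
  exists U, [/\ UltraFilter U, F `<=` U & forall k, exists2 Y, D k Y & U Y].
Proof.
move=> dense; pose C := {X | condition X /\ positive X}.
have /choice[next nextP] : forall kX : nat * C, exists Y : C,
    proj1_sig Y `<=` proj1_sig kX.2 /\ D kX.1 (proj1_sig Y).
  move=> [k [X [cX pX]]] /=; have [Y [YX cY pY DY]] := dense k X cX pX.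
  by exists (exist _ Y (conj cY pY)).
have CT : condition [set: nat -> M] /\ positive [set: nat -> M].
  split; last by move=> A FA; have [e Ae] := filter_ex FA; exists e.
  by split; [exact: definable_true|exists 0].
pose X := fix X k : C := if k is k'.+1 then next (k', X k') else exist _ _ CT.
have X_mono i j : i <= j -> proj1_sig (X j) `<=` proj1_sig (X i).
  elim: j => [|j IH]; first by rewrite leqn0 => /eqP ->.
  rewrite leq_eqVlt => /orP[/eqP ->//|/IH ij].
  by apply: subset_trans ij; exact: (nextP (j, X j)).1.
pose G : set_system (nat -> M) :=
  [set B | exists A k, F A /\ A `&` proj1_sig (X k) `<=` B].
have GF : ProperFilter G.
  split=> [[A [k [FA h]]]|].
    by have [e /h] := (proj2_sig (X k)).2 A FA.
  split.
  - by exists setT, 0; split=> //; exact: filterT.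
  - move=> B B' [A [k [FA h]]] [A' [k' [FA' h']]].
    exists (A `&` A'), (maxn k k'); split; first exact: filterI.
    move=> e [[Ae A'e] Xe]; split.
      by apply: h; split=> //; apply: X_mono Xe; exact: leq_maxl.
    by apply: h'; split=> //; apply: X_mono Xe; exact: leq_maxr.
  - move=> B B' BB' [A [k [FA h]]]; exists A, k; split=> //.
    exact: subset_trans BB'.
have [U [UU GU]] := ultraFilterLemma GF.
exists U; split=> // [A FA|k].
  by apply: GU; exists A, 0; split=> // e [].
exists (proj1_sig (X k.+1)); first exact: (nextP (k, X k)).2.
by apply: GU; exists setT, k.+1; split=> [|e []//]; exact: filterT.
Qed.

End Generic.

(** * Realising and omitting types in countable models *)

Section RyllNardzewski.
Context (L : language) (M : structure L).
Hypothesis countableL : countable_language L.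

(* The dense families O k make room for further genericity requirements, such
   as omitting a type. *)
Lemma henkin_ultrafilter (F : set_system (nat -> M)) (n0 : nat)
    (O : nat -> set (set (nat -> M))) :
  ProperFilter F ->
  (forall A, F A -> exists B, [/\ F B, B `<=` A & depends_below n0 B]) ->
  (forall k X, condition X -> positive F X ->
     exists Y, [/\ Y `<=` X, condition Y, positive F Y & O k Y]) ->
  exists U, [/\ UltraFilter U, F `<=` U,
    henkin U (fun (j : nat) (e : nat -> M) => e j) &
    forall k, exists2 Y, O k Y & U Y].
Proof.
move=> FF Fn0 denseO; have [code code_inj] := formula_countable countableL.
pose ex psi := [set e : nat -> M | exists x, sat (env_cons x e) psi].
pose wit psi j := [set e : nat -> M | sat (env_cons (e j) e) psi].
(* Requirement [k] decides the formula with code [k]: either it has no witness anywhere on [Y], or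
   one fixed coordinate is a witness throughout [Y]. *)
pose H k : set (set (nat -> M)) := [set Y | forall psi, code psi = k ->
  Y `<=` ~` ex psi \/ exists j, Y `<=` wit psi j].
have denseH k X : condition X -> positive F X ->
    exists Y, [/\ Y `<=` X, condition Y, positive F Y & H k Y].
  move=> cX pX; case: (pselect (exists psi, code psi = k)) => [[psi <-]|nk]; last first.
    by exists X; split=> // psi kpsi; exfalso; apply: nk; exists psi.
  have [[dX [m mX]] [S fS SP]] := (cX, sat_support psi).
  have [m' m'S] : exists m', forall j, S (Some j) -> j < m'.
    have /finite_seqP[s sE] : finite_set (Some @^-1` S).
      by apply: finite_preimage fS => ? ? _ _ [].
    exists (\max_(j <- s) j).+1 => j Sj; rewrite ltnS.
    have js : j \in s by have : (Some @^-1` S) j := Sj; rewrite sE.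
    exact: (@leq_bigmax_seq _ s xpredT id j).
  have dpsi : definable [set e : option nat -> M | sat e psi] by exists psi.
  have dex : definable (ex psi) by exact: definable_exists dpsi.
  have mex : depends_below m' (ex psi).
    move=> e e' ee' [x h]; exists x; apply: SP h => -[j|]//= /m'S; exact: ee'.
  case: (pselect (positive F (X `&` ex psi))) => [pXex|/existsNP[A /not_implyP[FA nA]]].
    (* The coordinate [l] lies beyond all that [X], [psi] and a base of [F] read, so a witness can
       be written into it freely. *)
    pose l := maxn n0 (maxn m m').
    have [n0l [ml m'l]] : n0 <= l /\ m <= l /\ m' <= l.
      by rewrite /l !leq_max !leqnn !orbT.
    exists (X `&` wit psi l); split.
    - by move=> e [].
    - split.
        apply: definable_and => //.
        have := definable_rename (fun v => if v is Some j then j else l) dpsi.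
        apply: definable_ext => e; rewrite /wit /=; set e' := _ \o _.
        by have <- // : e' = env_cons (e l) e by apply/funext => -[].
      exists l.+1 => e e' ee' [Xe we]; split.
        by apply: mX Xe => j jm; apply: ee'; rewrite ltnS (leq_trans (ltnW jm)).
      apply: SP we => -[j|] /= Sj; apply: ee' => //.
      by rewrite ltnS (leq_trans (ltnW (m'S _ Sj))).
    - move=> A /Fn0[B [FB BA Bn0]].
      have [e [Be [Xe [x xe]]]] := pXex B FB.
      exists (fun j => if j == l then x else e j).
      have eqe b j : b <= l -> j < b -> e j = (if j == l then x else e j).
        by move=> bl jb; rewrite ifF // ltn_eqF // (leq_trans jb).
      split; first by apply: BA; apply: Bn0 Be => j; exact: eqe.
      split; first by apply: mX Xe => j; exact: eqe.
      rewrite /wit /= eqxx; apply: SP xe => -[j|]//= /m'S; exact: eqe.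
    - by move=> psi' /code_inj ->; right; exists l => e [].
  (* Some [A] in [F] has no point in both [X] and [ex psi], so restricting [X] to the complement of
     [ex psi] keeps it compatible with [F]. *)
  exists (X `&` ~` ex psi); split.
  - by move=> e [].
  - split; first by apply: definable_and => //; exact: definable_setC.
    exists (maxn m m') => e e' ee' [Xe nex]; split.
      by apply: mX Xe => j jm; apply: ee'; rewrite leq_max jm.
    move=> ex'; apply: nex; apply: mex ex' => j jm.
    by rewrite ee' // leq_max jm orbT.
  - move=> B FB; have [e [[Ae Be] Xe]] := pX _ (filterI FA FB).
    by exists e; split=> //; split=> // exe; apply: nA; exists e.
  - by move=> psi' /code_inj ->; left=> e [].
have [|U [UU FU UD]] := @rasiowa_sikorski L M F FF (fun k => [set Y | H k Y /\ O k Y]).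
  move=> k X cX pX; have [Y [YX cY pY HY]] := denseH k X cX pX.
  have [Z [ZY cZ pZ OZ]] := denseO k Y cY pY.
  exists Z; split=> //; first exact: subset_trans YX.
  split=> // psi /HY[h|[j h]]; [left|right; exists j]; exact: subset_trans h.
exists U; split=> //; last by move=> k; have [Y [_ OY] UY] := UD k; exists Y.
(* Renaming along [a] turns variables of any type into coordinates, where the requirements apply. *)
move=> V psi a Ux; pose psi' := rename (omap a) psi.
have env x (e : nat -> M) :
    env_cons x (fun v => e (a v)) = env_cons x e \o omap a.
  by rewrite env_cons_omap.
have [Y [HY _] UY] := UD (code psi').
have [Yn|[j Yw]] := HY psi' erefl.
  exfalso; apply: (@filter_not_empty _ U); apply: filterS2 Ux UY => e [x xe] /Yn.
  by apply; exists x; rewrite sat_rename -env.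
exists j; apply: filterS UY => e /Yw.
by rewrite /wit /= sat_rename -env.
Qed.

Lemma isomorphic_sat (N N' : structure L) (h : N -> N') V (e : V -> N)
    (phi : formula L V) :
  bijective h ->
  (forall (f : funs L) (a : 'I_(fun_arity f) -> N),
      h (fun_int (interp N) a) = fun_int (interp N') (h \o a)) ->
  (forall (r : rels L) (a : 'I_(rel_arity r) -> N),
      rel_int (interp N) a <-> rel_int (interp N') (h \o a)) ->
  sat e phi <-> sat (h \o e) phi.
Proof.
move=> hb hf hr.
have evalh W (d : W -> N) t : h (eval d t) = eval (h \o d) t.
  elim: t => //= f ts IH; rewrite hf; congr (fun_int _ _).
  by apply/funext => i /=.
elim: phi e => {V} [V|V t u|V r ts|V psi IHpsi chi IHchi|V psi IH] e //=.
- by rewrite -!evalh; split=> [->//|/(bij_inj hb)].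
- rewrite hr (_ : h \o _ = (fun i => eval (h \o e) (ts i))) //.
  by apply/funext => i /=.
- by rewrite IHpsi IHchi.
- have env x : env_cons (h x) (h \o e) = h \o env_cons x e by apply/funext => -[].
  split=> [H y|H x]; last by apply/IH; rewrite -env.
  by have [h' _ h'K] := hb; rewrite -(h'K y) env; apply/IH.
Qed.

Lemma germ_countable (U : set_system (nat -> M)) :
  countable [set: germ U (fun (j : nat) (e : nat -> M) => e j)].
Proof.
apply/countable_injP; exists (@germ_repr _ _ _ _ _ _) => q q' _ _ qq'.
by rewrite -(germ_reprK q) qq' germ_reprK.
Qed.

(** With infinitely many definable sets there would be a complete type [p] that no definable set
    isolates. One countable model realises [p] and another omits it, yet both are isomorphic to
    [N]. *)
Theorem ryll_nardzewski n : omega_categorical M ->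
  finite_set [set X : set ('I_n.+1 -> M) | definable X].
Proof.
move=> [N [_ _ Nuniq]]; apply: contrapT => infD.
(* An atom isolates a complete type. A set is in [G0] if finitely many atoms cover its complement;
   were [G0] improper, all definable sets would be unions of finitely many fixed atoms. *)
pose atom (A : set ('I_n.+1 -> M)) := [/\ definable A, A !=set0 &
  forall X, definable X -> A `<=` X \/ A `<=` ~` X].
pose G0 : set_system ('I_n.+1 -> M) := [set B | exists s : seq (set ('I_n.+1 -> M)),
  (forall A, A \in s -> atom A) /\ (forall a, B a \/ exists2 A, A \in s & A a)].
have G0F : ProperFilter G0.
  split=> [[s [s_atom s_cover]]|].
    apply: infD.
    pose W := [set: {set 'I_(size s)}].
    apply: (@sub_finite_set _ _ ((fun w : {set 'I_(size s)} =>
      [set a | exists2 i, i \in w & nth set0 s i a]) @` W)); last first.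
      exact/finite_image/finite_finset.
    move=> X dX; exists [set i : 'I_(size s) | `[< nth set0 s i `<=` X >]]%SET => //.
    apply/seteqP; split=> [a [i]|a Xa]; first by rewrite inE => /asboolP; apply.
    have [//|[A As Aa]] := s_cover a.
    have iA : (index A s < size s)%N by rewrite index_mem.
    exists (Ordinal iA); rewrite /= ?nth_index // inE; apply/asboolP => /=.
    rewrite nth_index //; have [_ _ /(_ X dX)[//|AX]] := s_atom A As.
    by have := AX a Aa.
  split.
  - by exists [::]; split=> // a; left.
  - move=> B B' [s [s1 s2]] [s' [s1' s2']]; exists (s ++ s'); split.
      by move=> A; rewrite mem_cat => /orP[/s1|/s1'].
    move=> a; have [Ba|[A As Aa]] := s2 a; last first.
      by right; exists A => //; rewrite mem_cat As.
    have [B'a|[A As Aa]] := s2' a; first by left.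
    by right; exists A => //; rewrite mem_cat As orbT.
  - move=> B B' BB' [s [s1 s2]]; exists s; split=> // a.
    by have [/BB'|] := s2 a; [left|right].
have [p [pU G0p]] := ultraFilterLemma G0F.
have p_atom A : atom A -> ~ p A.
  move=> atA; apply/(ultra_setC _ pU)/G0p; exists [:: A]; split.
    by move=> B; rewrite inE => /eqP ->.
  move=> a; case: (pselect (A a)) => Aa; last by left.
  by right; exists A => //; rewrite mem_head.
pose g (j : nat) (e : nat -> M) := e j.
pose f0 (i : 'I_n.+1) : nat := i.
pose realised (K : structure L) := exists a : 'I_n.+1 -> K,
  forall phi : formula L 'I_n.+1, p [set b | sat b phi] -> sat a phi.
have [N1 [cN1 mN1 rN1]] : exists N1 : structure L,
    [/\ countable [set: N1], models N1 (Th M) & realised N1].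
  (* Realising [p]: its sets are pulled back to the first [n.+1] coordinates, whose germs then
     realise it. *)
  pose F : set_system (nat -> M) := [set A | exists2 B, p B & [set e : nat -> M | B (e \o f0)] `<=` A].
  have FF : ProperFilter F.
    split=> [[B pB h]|].
      have [b Bb] := filter_ex pB; apply: (h (fun j => b (inord j))) => /=.
      by rewrite (_ : _ \o _ = b) //; apply/funext => i /=; rewrite inord_val.
    split.
    - by exists setT => //; exact: filterT.
    - move=> A A' [B pB BA] [B' pB' BA']; exists (B `&` B'); first exact: filterI.
      by move=> e [/BA ? /BA' ?].
    - by move=> A A' AA' [B pB BA]; exists B => //; exact: subset_trans AA'.
  have [||U [UU FU hU _]] := @henkin_ultrafilter F n.+1 (fun _ => setT) FF.
  - move=> A [B pB BA]; exists [set e : nat -> M | B (e \o f0)]; split=> //.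
      by exists B.
    move=> e e' ee' /=; rewrite (_ : e \o f0 = e' \o f0) //.
    by apply/funext => i; apply: ee'; exact: ltn_ord.
  - by move=> k X cX pX; exists X; split.
  exists (germ_structure UU hU); split.
  - exact: germ_countable.
  - exact: germ_structure_models.
  exists (germ_of U g \o f0) => phi pphi.
  by apply/(los_sat UU hU)/FU; exists [set b | sat b phi].
have [N2 [cN2 mN2 oN2]] : exists N2 : structure L,
    [/\ countable [set: N2], models N2 (Th M) & ~ realised N2].
  pose F : set_system (nat -> M) := [set setT].
  have [e0 _] : exists e : nat -> M, True.
    by have [b _] := filter_ex (@filterT _ p _); exists (fun=> b ord0).
  have FF : ProperFilter F.
    split; first by move=> /seteqP[_ /(_ e0)]; apply.
    split=> [//|A B -> ->|A B AB AT]; first by rewrite /F /= setIT.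
    by apply/seteqP; split=> // e _; apply: AB; rewrite AT.
  (* Omitting [p]: requirement [k] makes the tuple of coordinates with code [k] violate some formula
     of [p]. *)
  pose O k : set (set (nat -> M)) := [set Y : set (nat -> M) |
    forall f : {ffun 'I_n.+1 -> nat}, choice.pickle f = k ->
      exists2 phi : formula L 'I_n.+1, p [set b | sat b phi] &
        forall e : nat -> M, Y e -> ~ sat (e \o f) phi].
  have [||U [UU FU hU UO]] := @henkin_ultrafilter F 0 O FF.
  - by move=> A ->; exists setT; split.
  - move=> k X cX pX.
    case: (pselect (exists f : {ffun 'I_n.+1 -> nat}, choice.pickle f = k)) => [[f fk]|nf];
      last by exists X; split=> // f fk; exfalso; apply: nf; exists f.
    have [dX [m mX]] := cX.
    pose A := [set a : 'I_n.+1 -> M | exists2 e, X e & e \o f = a].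
    have dA : definable A by apply: definable_projection mX dX.
    have [phi pphi [a Aa nphi]] : exists2 phi : formula L 'I_n.+1,
        p [set b | sat b phi] & exists2 a, A a & ~ sat a phi.
      (* If all formulas of [p] held throughout [A], then [A] would be an atom, since [p] decides
         every definable set. But [p] contains no atom, and it cannot contain the complement of the
         nonempty [A]. *)
      apply: contrapT => nphi.
      have below phi : p [set b | sat b phi] -> A `<=` [set b | sat b phi].
        move=> pphi a Aa; apply: contrapT => na.
        by apply: nphi; exists phi => //; exists a.
      have atA : atom A.
        split=> //.
          by have [e [_ Xe]] := pX _ (erefl : F setT); exists (e \o f), e.
        move=> Y [phi phiP].
        have [/below|pn] := in_ultra_setVsetC [set b | sat b phi] pU.
          by move=> h; left=> a /h /phiP.
        by right=> a /(below (fnot phi) pn) /= na /phiP.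
      have [phi phiP] := dA.
      have [pA|pn] := in_ultra_setVsetC A pU; first exact: p_atom pA.
      have [_ [a Aa] _] := atA.
      have : p [set b | sat b (fnot phi)].
        by apply: filterS pn => b /= nAb /phiP.
      by move=> /below /(_ a Aa) /=; apply; apply/phiP.
    have dphi : definable [set e : nat -> M | ~ sat (e \o f) phi].
      apply: definable_setC; apply: (@definable_rename _ _ _ _ f [set b | sat b phi]).
      by exists phi.
    exists (X `&` [set e : nat -> M | ~ sat (e \o f) phi]); split.
    + by move=> e [].
    + split; first exact: definable_and.
      exists (maxn m (\max_i f i).+1) => e e' ee' [Xe ne]; split.
        by apply: mX Xe => j jm; apply: ee'; rewrite leq_max jm.
      move=> /=; rewrite (_ : e' \o f = e \o f) //; apply/funext => i /=.
      by rewrite ee' // leq_max ltnS leq_bigmax orbT.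
    + move=> B ->; have [e Xe ea] := Aa; exists e; split=> //; split=> //=.
      by rewrite ea.
    + move=> f' f'k; have -> : f' = f.
        by apply: (pcan_inj choice.pickleK); rewrite f'k.
      by exists phi => // e [].
  exists (germ_structure UU hU); split.
  - exact: germ_countable.
  - exact: germ_structure_models.
  (* Every tuple of this model consists of germs of coordinates, so one of the requirements concerns
     it. *)
  move=> [a ap]; pose f : {ffun 'I_n.+1 -> nat} := [ffun i => germ_repr (a i)].
  have af : a = germ_of U g \o f.
    by apply/funext => i; rewrite /= ffunE; symmetry; exact: germ_reprK.
  have [Y OY UY] := UO (choice.pickle f).
  have [phi /ap + nphi] := OY f erefl; rewrite af => /(los_sat UU hU) Uphi.
  apply: (@filter_not_empty _ U); apply: filterS2 Uphi UY => e /= se /nphi.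
  by apply.
have [h1 [h1b h1f h1r]] := Nuniq N1 cN1 mN1.
have [h2 [h2b h2f h2r]] := Nuniq N2 cN2 mN2.
have [h1' h1K h1'K] := h1b; have [a ap] := rN1.
apply: oN2; exists (h2 \o (h1' \o a)) => phi /ap.
have {1}-> : a = h1 \o (h1' \o a) by apply/funext => i /=; rewrite h1'K.
move=> /(isomorphic_sat _ _ h1b h1f h1r) s1.
exact/(isomorphic_sat _ _ h2b h2f h2r).
Qed.

End RyllNardzewski.

Import GRing.Theory.
Local Open Scope ring_scope.

Lemma finite_sumset (V : zmodType) n (A : 'I_n -> set V) :
  (forall i, finite_set (A i)) ->
  finite_set [set x | exists2 u : 'I_n -> V, forall i, A i (u i) & x = \sum_i u i].
Proof.
elim: n A => [|n IH] A fA.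
  apply: (@sub_finite_set _ _ [set 0]) => // x [u _ ->] /=.
  by rewrite big_ord0.
have := finite_image2 (fun x y => x + y) (fA ord0) (IH _ (fun i => fA (lift ord0 i))).
apply: sub_finite_set => x [u uA ->].
exists (u ord0) => //; exists (\sum_i u (lift ord0 i)).
  by exists (fun i => u (lift ord0 i)).
by rewrite big_ord_recl.
Qed.

(** * Division rings of bounded exponent *)

Section BoundedExponent.
Context (D : unitRingType) (n : nat).
Hypothesis n_gt0 : (0 < n)%N.
Hypothesis expD : forall x : D, x != 0 -> x ^+ n = 1.
Implicit Types (a c x y : D) (s : seq D).

Lemma exp_unit x : x != 0 -> x \is a GRing.unit.
Proof.
move=> x0; apply/unitrP; exists (x ^+ n.-1).
by rewrite -exprS -exprSr prednK // expD.
Qed.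

Lemma exp_mulf_eq0 x y : x * y = 0 -> x != 0 -> y = 0.
Proof. by move=> xy /exp_unit ux; apply: (mulrI ux); rewrite xy mulr0. Qed.

Definition centralizer s : set D := [set x | forall c, c \in s -> GRing.comm x c].

(* Frobenius: if p = char D divided the order of a, then a^(order / p) - 1
   would be a nilpotent, hence zero. *)
Lemma order_natr_neq0 a N : (0 < N)%N -> a ^+ N = 1 ->
  (forall k, (0 < k < N)%N -> a ^+ k != 1) -> N%:R != 0 :> D.
Proof.
move=> N_gt0 aN a_min; apply/negP => /eqP N0.
have [p pP] : exists p, p \in [pchar D].
  have exN : exists k, (0 < k)%N && (k%:R == 0 :> D) by exists N; rewrite N_gt0 N0 eqxx.
  (* The least positive integer that vanishes in [D] is prime, since a proper factorisation would
     give zero divisors. *)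
  case: (ex_minnP exN) => p /andP[p_gt0 /eqP p0] p_min.
  exists p; rewrite !inE p0 eqxx andbT; apply/primeP; split.
    by case: p p_gt0 p0 {p_min} => [|[|p]] // _ /eqP; rewrite oner_eq0.
  move=> d dp; have d_gt0 : (0 < d)%N by exact: dvdn_gt0 p_gt0 dp.
  have [d0|dn0] := eqVneq (d%:R : D) 0.
    by apply/orP; right; rewrite eqn_leq dvdn_leq //= p_min // d_gt0 d0 eqxx.
  have e0 : (p %/ d)%:R = 0 :> D.
    by apply: exp_mulf_eq0 dn0; rewrite -natrM mulnC divnK.
  have e_gt0 : (0 < p %/ d)%N by rewrite divn_gt0 // dvdn_leq.
  have : (p <= p %/ d)%N by rewrite p_min // e_gt0 e0 eqxx.
  by rewrite leqNgt; case: d dp d_gt0 {dn0 e0 e_gt0} => [|[|d]] //; rewrite ltn_Pdiv.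
have p_pr : prime p by case/andP: pP.
have pN : (p %| N)%N by rewrite (dvdn_pcharf pP) N0.
pose t := (N %/ p)%N.
have t_gt0 : (0 < t)%N by rewrite divn_gt0 ?prime_gt0 // dvdn_leq.
have tN : (t < N)%N by rewrite ltn_Pdiv // prime_gt1.
have := a_min t; rewrite t_gt0 tN => /(_ isT); rewrite -subr_eq0 => at1.
have : (a ^+ t - 1) ^+ p = 0.
  have := pFrobenius_autB_comm pP (commr1 (a ^+ t)).
  by rewrite !pFrobenius_autE expr1n -exprM divnK // aN subrr.
by move=> atp; move/exp_unit: at1 => /(unitrX p); rewrite atp unitr0.
Qed.

Lemma centralizerM s x y :
  centralizer s x -> centralizer s y -> centralizer s (x * y).
Proof.
by move=> xs ys c cs; apply/commr_sym/commrM; apply: commr_sym; [exact: xs|exact: ys].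
Qed.

Lemma centralizerX s x k : centralizer s x -> centralizer s (x ^+ k).
Proof. by move=> xs c cs; apply/commr_sym/commrX/commr_sym/xs. Qed.

Lemma centralizerV s x : centralizer s x -> centralizer s x^-1.
Proof. by move=> xs c cs; apply/commr_sym/commrV/commr_sym/xs. Qed.

(* The eigenspaces of conjugation by a have eigenvalues in the group generated
   by a, because a is itself a primitive root of unity of the order of that
   conjugation; each of them is a coset of the centralizer of a. *)
Lemma centralizer_cons_finite a s : centralizer s a ->
  finite_set (centralizer (a :: s)) -> finite_set (centralizer s).
Proof.
move=> sa fin_as; have [a0|a0] := eqVneq a 0.
  apply: sub_finite_set fin_as => x xs c; rewrite inE => /predU1P[->|/xs//].
  by rewrite a0; exact: commr0.
have ua := exp_unit a0.
have exN : exists k, (0 < k)%N && (a ^+ k == 1) by exists n; rewrite n_gt0 expD ?eqxx.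
case: (ex_minnP exN) => N /andP[N_gt0 /eqP aN] N_min.
have a_min k : (0 < k < N)%N -> a ^+ k != 1.
  by move=> /andP[k_gt0 kN]; apply/negP => ak; move: kN; rewrite ltnNge N_min ?k_gt0 ?ak.
have N0 := order_natr_neq0 N_gt0 aN a_min.
pose b := a^-1.
have bN : b ^+ N = 1 by rewrite exprVn aN invr1.
have b_min k : (0 < k < N)%N -> b ^+ k != 1.
  by move=> /a_min; rewrite exprVn; apply: contra => /eqP ak; rewrite -(invrK (a ^+ k)) ak invr1.
(* A discrete Fourier transform with root of unity [b]: [rho j] is [N] times the projection onto the
   solutions of [x * a = a ^+ j * x]. *)
pose h j d i := b ^+ (i * j) * d * a ^+ i.
pose rho j d := \sum_(i < N) h j d i.
have rho_eig j d : rho j d * a = a ^+ j * rho j d.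
  have shift : \sum_(i < N) h j d i.+1 = rho j d.
    apply: (addrI (h j d 0%N)).
    rewrite -(big_ord_recl N (fun i : 'I_N.+1 => h j d i)) big_ord_recr /= addrC.
    by rewrite /h mul0n !expr0 aN mulnC exprM -exprM mulnC exprM bN expr1n.
  rewrite -[in RHS]shift mulr_suml mulr_sumr; apply: eq_bigr => i _.
  have ab : a ^+ j * b ^+ j = 1 by rewrite exprVn mulrV ?unitrX.
  by rewrite /h mulSn exprD exprSr !mulrA ab mul1r.
have rho_sum d : \sum_(j < N) rho j d = N%:R * d.
  rewrite exchange_big /= (bigD1 (Ordinal N_gt0)) //= [X in _ + X]big1 ?addr0.
    rewrite (eq_bigr (fun=> d)) => [|j _]; last by rewrite /h /= mul0n !expr0 mul1r mulr1.
    by rewrite sumr_const card_ord mulr_natl.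
  move=> i i0; rewrite /h -!mulr_suml.
  have iN : (0 < i < N)%N by rewrite lt0n ltn_ord andbT; exact: i0.
  (* A geometric sum over the powers of a nontrivial [N]-th root of unity vanishes. *)
  suff -> : \sum_(j < N) b ^+ (i * j) = 0 by rewrite !mul0r.
  have := subrX1 (b ^+ i) N; rewrite -exprM mulnC exprM bN expr1n subrr.
  move=> /esym/exp_mulf_eq0; rewrite subr_eq0 => /(_ (b_min _ iN)) bi.
  by rewrite -[RHS]bi; apply: eq_bigr => j _; rewrite exprM.
have rho_s j d : centralizer s d -> centralizer s (rho j d).
  move=> ds c cs; rewrite /GRing.comm mulr_suml mulr_sumr; apply: eq_bigr => i _.
  have : centralizer s (h j d i) by do !apply: centralizerM => //;
    apply: centralizerX => //; exact: centralizerV.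
  exact.
pose E j := [set x | centralizer s x /\ x * a = a ^+ j * x].
have fE j : finite_set (E j).
  have [[x0 [[x0s x0a] x00]]|nE] := pselect (exists x, E j x /\ x != 0); last first.
    apply: (@sub_finite_set _ _ [set 0]) => // x Ex; apply: contrapT => /eqP x0.
    by apply: nE; exists x.
  have ux0 := exp_unit x00.
  apply: sub_finite_set (finite_image (fun y => x0 * y) fin_as) => x [xs xa].
  exists (x0^-1 * x); last by rewrite mulVKr.
  move=> c; rewrite inE => /predU1P[->|cs]; last first.
    by apply: centralizerM cs => //; exact: centralizerV.
  rewrite /GRing.comm -mulrA xa; apply: (mulrI ux0).
  by rewrite mulVKr // (mulrA x0) x0a -!mulrA mulVKr.
have uN := exp_unit N0.
apply: sub_finite_set (finite_image (fun y => (N%:R : D)^-1 * y)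
  (finite_sumset (fun j : 'I_N => fE j))) => d ds.
exists (N%:R * d); last by rewrite mulKr.
by exists (fun j : 'I_N => rho j d) => [j|]; [split; [exact: rho_s|exact: rho_eig]|rewrite rho_sum].
Qed.

(** Distinct commuting elements are roots of a polynomial of degree [n.+1], so their number is
    bounded. A longest such list contains its centralizer, which is thus finite; dropping entries
    one by one leads to the centralizer of the empty list, all of [D]. *)
Lemma bounded_exponent_finite : finite_set [set: D].
Proof.
pose commuting s := uniq s /\ {in s &, forall x y, GRing.comm x y}.
have sizeP s : commuting s -> (size s < n.+2)%N.
  move=> [us cs]; have q0 : 'X^(n.+1) - 'X != 0 :> {poly D}.
    apply/negP => /eqP /(congr1 (fun q : {poly D} => q`_n.+1)).
    rewrite coefB coefXn coefX coef0 eqxx eqSS (gtn_eqF n_gt0) subr0.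
    by move/eqP; rewrite oner_eq0.
  have := @max_ring_poly_roots D ('X^(n.+1) - 'X) s q0.
  have -> : size ('X^(n.+1) - 'X : {poly D}) = n.+2.
    by rewrite size_polyDl ?size_polyN ?size_polyXn ?size_polyX.
  apply.
    apply/allP => x _; rewrite rootE hornerD hornerN hornerX.
    rewrite hornerXn; have [->|x0] := eqVneq x 0; first by rewrite exprS mul0r subr0.
    by rewrite exprSr expD // mul1r subrr.
  elim: s us cs => //= x s IH /andP[xs us] cs; rewrite IH //= ?andbT.
    apply/allP => y ys; rewrite /diff_roots; apply/andP; split.
      by apply/eqP; apply: cs; rewrite inE ?eqxx ?ys ?orbT.
    by apply: exp_unit; rewrite subr_eq0; apply: contraNneq xs => <-.
  by move=> y z ys zs; apply: cs; rewrite inE ?ys ?zs orbT.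
have exs : exists k, `[< exists2 s, commuting s & size s = k >].
  by exists 0%N; apply/asboolP; exists [::].
have bnd k : `[< exists2 s, commuting s & size s = k >] -> (k <= n.+1)%N.
  by move=> /asboolP[s /sizeP + <-].
case: (ex_maxnP exs bnd) => k /asboolP[s [us cs] <-] k_max.
have fin_s : finite_set (centralizer s).
  apply: (@sub_finite_set _ _ [set` s]); last exact: finite_seq.
  move=> x xs /=; apply/negPn/negP => xns; suff : (size s < size s)%N by rewrite ltnn.
  apply: k_max; apply/asboolP; exists (x :: s) => //; split=> /=; first by rewrite xns.
  move=> y z; rewrite !inE => /predU1P[->|ys] /predU1P[->|zs] //.
  - exact: xs.
  - exact/commr_sym/xs.
  - exact: cs.
elim: s {us k_max} cs fin_s => [|a s IH] cs fin_s.
  by apply: sub_finite_set fin_s => x _.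
apply: IH; first by move=> y z ys zs; apply: cs; rewrite inE ?ys ?zs orbT.
apply: centralizer_cons_finite fin_s => c c_s.
by apply: cs; rewrite inE ?eqxx ?c_s ?orbT.
Qed.

End BoundedExponent.

(** * Rings without unit *)

Local Notation "x ** y" := (rmul x y) (at level 40, left associativity).

Section RngTheory.
Context (Q : rngType).
Implicit Types x y z : Q.

Lemma rmul0r x : 0 ** x = 0.
Proof. by apply: (addIr (0 ** x)); rewrite -rmulDl !add0r. Qed.

Lemma rmulr0 x : x ** 0 = 0.
Proof. by apply: (addIr (x ** 0)); rewrite -rmulDr !add0r. Qed.

Lemma rmulNr x y : (- x) ** y = - (x ** y).
Proof. by apply: (addIr (x ** y)); rewrite -rmulDl !addNr rmul0r. Qed.

Lemma rmulrN x y : x ** (- y) = - (x ** y).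
Proof. by apply: (addIr (x ** y)); rewrite -rmulDr !addNr rmulr0. Qed.

Lemma rmulBl x y z : (x - y) ** z = x ** z - y ** z.
Proof. by rewrite rmulDl rmulNr. Qed.

Lemma rmulBr x y z : x ** (y - z) = x ** y - x ** z.
Proof. by rewrite rmulDr rmulrN. Qed.

Lemma rmul_suml I (r : seq I) (P : pred I) (F : I -> Q) x :
  (\sum_(i <- r | P i) F i) ** x = \sum_(i <- r | P i) F i ** x.
Proof.
elim/big_rec2: _ => [|i y z _ <-]; first by rewrite rmul0r.
by rewrite rmulDl.
Qed.

Lemma rmul_sumr I (r : seq I) (P : pred I) (F : I -> Q) x :
  x ** (\sum_(i <- r | P i) F i) = \sum_(i <- r | P i) x ** F i.
Proof.
elim/big_rec2: _ => [|i y z _ <-]; first by rewrite rmulr0.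
by rewrite rmulDr.
Qed.

(* rpow x k is the power of exponent k + 1. *)
Fixpoint rpow x k := if k is k'.+1 then rpow x k' ** x else x.

Lemma rpowD x i j : rpow x i ** rpow x j = rpow x (i + j).+1.
Proof. by elim: j => [|j IH]; rewrite ?addn0 ?addnS //= rmulA IH. Qed.

Lemma rpow_mulE x k z : rpow x k ** z = iter k.+1 (rmul x) z.
Proof. by elim: k z => //= k IH z; rewrite -rmulA IH -iterSr. Qed.

Lemma iter_rmul0 k x : iter k (rmul x) 0 = 0.
Proof. by elim: k => //= k ->; exact: rmulr0. Qed.

Lemma rpow_comm x y k : rpow (x ** y) k ** x = x ** rpow (y ** x) k.
Proof.
by elim: k => [|k IH] /=; rewrite !rmulA // IH.
Qed.

Lemma rpow_mull x y k : exists z, rpow (x ** y) k = x ** z.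
Proof.
elim: k => [|k [z /= ->]]; first by exists y.
by exists (z ** (x ** y)); rewrite -rmulA.
Qed.

Lemma rpow_mulr x y k : exists z, rpow (x ** y) k = z ** y.
Proof.
case: k => [|k] /=; first by exists x.
by exists (rpow (x ** y) k ** x); rewrite !rmulA.
Qed.

(** Powers are periodic from [i] on with period [j - i]. Raising to a multiple of the period that
    exceeds [i] yields idempotents; [n] is one less because of the shift in [rpow]. *)
Lemma rpow_idempotent i j : (i < j)%N -> (forall x, rpow x i = rpow x j) ->
  exists n, forall x, rpow x n ** rpow x n = rpow x n.
Proof.
move=> ij eqij; pose p := (j - i)%N; have p_gt0 : (0 < p)%N by rewrite subn_gt0.
have period m x : (i <= m)%N -> rpow x (m + p) = rpow x m.
  move=> /subnK <-; elim: (m - i)%N => [|k IH]; last by rewrite !addSn /= IH.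
  by rewrite add0n addnC subnK // ltnW.
have periods k m x : (i <= m)%N -> rpow x (m + k * p) = rpow x m.
  move=> im; elim: k => [|k IH]; first by rewrite addn0.
  by rewrite mulSn addnCA addnC period ?IH // (leq_trans im) ?leq_addr.
exists (i.+1 * p).-1 => x; rewrite rpowD.
have m_gt0 : (0 < i.+1 * p)%N by rewrite muln_gt0.
rewrite -addnS prednK // periods // -ltnS prednK //.
by rewrite (leq_trans (ltnSn i)) // leq_pmulr.
Qed.

Definition semiprime : Prop := forall x, (forall r, x ** r ** x = 0) -> x = 0.

(* Levitzki: with c = (ax)^(k-1) one has c (c a) = 0, so expanding
   (c a r + c)^k a = 0 leaves (c a r)^(k-1) c a = 0, which is the hypothesis
   for c a in place of a and k - 1 in place of k. *)
Lemma levitzki : semiprime -> forall k a,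
  (forall x, iter k (rmul (a ** x)) a = 0) -> a = 0.
Proof.
move=> sp; elim=> [|[|k] IH] a Pa.
- exact: Pa 0.
- by apply: sp => r; have := Pa r.
apply: (IH) => x; rewrite -rpow_mulE; set c := rpow _ _.
have cca : c ** (c ** a) = 0.
  rewrite /c !rpow_mulE -iterD addSnnS iterD Pa.
  exact: iter_rmul0.
apply: IH => r; rewrite -rmulA; set u := c ** (a ** r).
have [z cz] : exists z, c = a ** z by exact: rpow_mull.
have cu y : c ** (u ** y) = 0.
  by rewrite /u !rmulA -(rmulA c c a) cca !rmul0r.
have expand j : iter j.+1 (rmul (u + c)) a =
    iter j.+1 (rmul u) a + iter j (rmul u) (c ** a).
  elim: j => [|j IHj]; first by rewrite /= rmulDl.
  rewrite iterS IHj rmulDl !rmulDr (cu (iter j _ _)) add0r.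
  by case: j {IHj} => [|j] /=; rewrite ?cca ?cu addr0.
(* Both [u + c] and [u] are left multiples by [a], so the hypothesis kills two of the three
   terms. *)
have := expand k.+1; have -> : u + c = a ** (z ** (a ** r) + z).
  by rewrite rmulDr rmulA -cz.
rewrite Pa; have -> : u = a ** (z ** (a ** r)) by rewrite /u cz -rmulA.
by rewrite Pa add0r.
Qed.

End RngTheory.

(** * Corner rings [e Q e] *)

Section Corner.
Context (Q : rngType) (e : Q) (n : nat).
Hypotheses (ee : e ** e = e) (e0 : e != 0).

Definition in_corner : pred Q := fun x => (e ** x == x) && (x ** e == x).
Definition corner : Type := {x : Q | in_corner x}.
HB.instance Definition _ := Choice.on corner.

Lemma corner_l (x : corner) : e ** val x = val x.
Proof. by have /andP[/eqP] := valP x. Qed.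

Lemma corner_r (x : corner) : val x ** e = val x.
Proof. by have /andP[_ /eqP] := valP x. Qed.

Lemma corner_zero_subproof : in_corner 0.
Proof. by rewrite /in_corner rmulr0 rmul0r eqxx. Qed.
Lemma corner_opp_subproof (x : corner) : in_corner (- val x).
Proof. by rewrite /in_corner rmulrN rmulNr corner_l corner_r eqxx. Qed.
Lemma corner_add_subproof (x y : corner) : in_corner (val x + val y).
Proof. by rewrite /in_corner rmulDr rmulDl !corner_l !corner_r eqxx. Qed.
Lemma corner_one_subproof : in_corner e.
Proof. by rewrite /in_corner ee eqxx. Qed.
Lemma corner_mul_subproof (x y : corner) : in_corner (val x ** val y).
Proof. by rewrite /in_corner rmulA -[X in _ && (X == _)]rmulA corner_l corner_r eqxx. Qed.

Definition corner_zero : corner := exist in_corner 0 corner_zero_subproof.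
Definition corner_opp (x : corner) : corner := exist in_corner _ (corner_opp_subproof x).
Definition corner_add (x y : corner) : corner := exist in_corner _ (corner_add_subproof x y).
Definition corner_one : corner := exist in_corner e corner_one_subproof.
Definition corner_mul (x y : corner) : corner := exist in_corner _ (corner_mul_subproof x y).

Lemma corner_addA : associative corner_add.
Proof. by move=> x y z; apply: val_inj; exact: addrA. Qed.
Lemma corner_addC : commutative corner_add.
Proof. by move=> x y; apply: val_inj; exact: addrC. Qed.
Lemma corner_add0 : left_id corner_zero corner_add.
Proof. by move=> x; apply: val_inj; exact: add0r. Qed.
Lemma corner_addN : left_inverse corner_zero corner_opp corner_add.
Proof. by move=> x; apply: val_inj; exact: addNr. Qed.

HB.instance Definition _ :=
  GRing.isZmodule.Build corner corner_addA corner_addC corner_add0 corner_addN.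

Lemma corner_mulA : associative corner_mul.
Proof. by move=> x y z; apply: val_inj; exact: rmulA. Qed.
Lemma corner_mul1l : left_id corner_one corner_mul.
Proof. by move=> x; apply: val_inj; exact: corner_l. Qed.
Lemma corner_mul1r : right_id corner_one corner_mul.
Proof. by move=> x; apply: val_inj; exact: corner_r. Qed.
Lemma corner_mulDl : left_distributive corner_mul +%R.
Proof. by move=> x y z; apply: val_inj; exact: rmulDl. Qed.
Lemma corner_mulDr : right_distributive corner_mul +%R.
Proof. by move=> x y z; apply: val_inj; exact: rmulDr. Qed.
Lemma corner_one_neq0 : corner_one != 0.
Proof. exact: e0. Qed.

HB.instance Definition _ := GRing.Zmodule_isNzRing.Build corner corner_mulA
  corner_mul1l corner_mul1r corner_mulDl corner_mulDr corner_one_neq0.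

Hypothesis pow_e : forall x, e ** x = x -> x ** e = x -> x != 0 -> rpow x n = e.

Lemma corner_val_exp (x : corner) k : val (x ^+ k.+1) = rpow (val x) k.
Proof. by elim: k => [|k IH]; rewrite ?expr1 // exprSr /= -IH. Qed.

Lemma corner_exp (x : corner) : x != 0 -> x ^+ n.+1 = 1.
Proof.
move=> x0; apply: val_inj; rewrite corner_val_exp.
by apply: pow_e; [exact: corner_l|exact: corner_r|exact: x0].
Qed.

(** As [x ^+ n.+1 = 1], the inverse is a power; the value at 0 follows the convention that inversion
    fixes non-units. *)
Definition corner_inv (x : corner) : corner := if x == 0 then x else x ^+ n.

Lemma corner_mulVr : {in [pred x : corner | x != 0], left_inverse 1 corner_inv *%R}.
Proof.
move=> x; rewrite inE /corner_inv => x0.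
by rewrite (negPf x0) -exprSr corner_exp.
Qed.
Lemma corner_divrr : {in [pred x : corner | x != 0], right_inverse 1 corner_inv *%R}.
Proof.
move=> x; rewrite inE /corner_inv => x0.
by rewrite (negPf x0) -exprS corner_exp.
Qed.
Lemma corner_unitrP (x y : corner) : y * x = 1 /\ x * y = 1 -> x != 0.
Proof.
by move=> [yx _]; apply/negP => /eqP x0; move/eqP: yx; rewrite x0 mulr0 eq_sym oner_eq0.
Qed.
Lemma corner_invr_out : {in [predC [pred x : corner | x != 0]], corner_inv =1 id}.
Proof. by move=> x; rewrite !inE negbK /corner_inv => ->. Qed.

HB.instance Definition _ := GRing.NzRing_hasMulInverse.Build corner
  corner_mulVr corner_divrr corner_unitrP corner_invr_out.

Lemma corner_finite : finite_set [set x | e ** x = x /\ x ** e = x].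
Proof.
have := bounded_exponent_finite (ltn0Sn n) corner_exp.
move=> /(finite_image (val : corner -> Q)); apply: sub_finite_set => x [ex xe].
have h : in_corner x by rewrite /in_corner ex xe eqxx.
by exists (exist in_corner x h : corner).
Qed.

End Corner.

(** * Finiteness of semiprime rings with boundedly many orthogonal idempotents *)

Section SemiprimeFinite.
Context (Q : rngType) (n K : nat).
Implicit Types x y : Q.
Hypothesis sp : semiprime Q.
Hypothesis pow_idem : forall x, rpow x n ** rpow x n = rpow x n.

Definition orthogonal_idempotents (k : nat) (e : nat -> Q) : Prop :=
  (forall i, (i < k)%N -> e i ** e i = e i /\ e i != 0) /\
  (forall i j, (i < k)%N -> (j < k)%N -> i != j -> e i ** e j = 0).

Hypothesis bounded : ~ exists e, orthogonal_idempotents K e.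

(** Levitzki gives [r] such that the power of [x ** r] times [x] is nonzero; this is [x] times the
    same power of [r ** x], which is therefore a nonzero idempotent. *)
Lemma idempotent_in_left_ideal x : x != 0 ->
  exists w, let f := w ** x in f ** f = f /\ f != 0.
Proof.
move=> /eqP x0; have [r xr] : exists r, iter n.+1 (rmul (x ** r)) x <> 0.
  by apply/existsNP => h; apply/x0/(levitzki sp h).
have [w wE] := rpow_mulr r x n; exists w; rewrite -wE; split; first exact: pow_idem.
apply/negP => /eqP f0; apply: xr.
by rewrite -rpow_mulE rpow_comm f0 rmulr0.
Qed.

Theorem semiprime_finite : finite_set [set: Q].
Proof.
have ex0 : exists k, `[< exists e, orthogonal_idempotents k e >].
  by exists 0%N; apply/asboolP; exists (fun=> 0); split.
have bnd k : `[< exists e, orthogonal_idempotents k e >] -> (k <= K)%N.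
  move=> /asboolP[e [e1 e2]]; rewrite leqNgt; apply/negP => Kk; apply: bounded.
  exists e; split=> [i iK|i j iK jK]; first by apply: e1; exact: ltn_trans Kk.
  by apply: e2; exact: ltn_trans Kk.
case: (ex_maxnP ex0 bnd) => k /asboolP[e [e_idem e_orth]] k_max {ex0 bnd}.
have no_more f : ~ orthogonal_idempotents k.+1 f.
  by move=> of_; have := k_max k.+1; rewrite ltnn; move=> h; have : false by
    apply: h; apply/asboolP; exists f.
pose u := \sum_(i < k) e i.
have ue j : (j < k)%N -> u ** e j = e j.
  move=> jk; rewrite rmul_suml (bigD1 (Ordinal jk)) //= big1 ?addr0.
    by have [] := e_idem j jk.
  by move=> i ij; apply: e_orth.
have eu j : (j < k)%N -> e j ** u = e j.
  move=> jk; rewrite rmul_sumr (bigD1 (Ordinal jk)) //= big1 ?addr0.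
    by have [] := e_idem j jk.
  by move=> i ij; apply: e_orth; rewrite // eq_sym.
(* Otherwise a nonzero idempotent [f] in the left ideal of [x - x ** u] yields [g = f - u ** f], an
   idempotent orthogonal to all [e i], against maximality. *)
have xu x : x ** u = x.
  apply/eqP; rewrite eq_sym -subr_eq0; apply/negPn/negP.
  set y := x - x ** u => /idempotent_in_left_ideal[w].
  have uu : u ** u = u.
    by rewrite {1}/u rmul_suml /u; apply: eq_bigr => i _; exact: eu.
  have yu : y ** u = 0 by rewrite rmulBl -rmulA uu subrr.
  set f := w ** y => -[ff f0]; have fu : f ** u = 0 by rewrite -rmulA yu rmulr0.
  pose g := f - u ** f.
  have ug : u ** g = 0 by rewrite rmulBr rmulA uu subrr.
  have gu : g ** u = 0 by rewrite rmulBl -rmulA fu rmulr0 subrr.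
  have fg : f ** g = f by rewrite rmulBr ff rmulA fu rmul0r subr0.
  have gg : g ** g = g by rewrite {1}/g rmulBl fg -rmulA fg.
  have g0 : g != 0 by apply: contraNneq f0 => g0; rewrite -fg g0 rmulr0.
  apply: (no_more (fun i => if (i < k)%N then e i else g)); split=> [i|i j]; rewrite !ltnS.
    by case: ltnP => // ik _; exact: e_idem.
  case: ltnP => ik; case: ltnP => jk iK jK ij.
  - exact: e_orth.
  - by rewrite -(eu _ ik) -rmulA ug rmulr0.
  - by rewrite -(ue _ jk) rmulA gu rmul0r.
  - by move: ij; rewrite (_ : i = j) ?eqxx //; apply/eqP; rewrite eqn_leq (leq_trans iK) ?(leq_trans jK).
(* Since [u] is a right unit, [r ** (x - u ** x) = 0] for all [r], and semiprimeness concludes. *)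
have ux x : u ** x = x.
  apply/eqP; rewrite eq_sym -subr_eq0; apply/eqP; apply: sp => r.
  by rewrite -rmulA rmulBr [r ** (u ** x)]rmulA xu subrr rmulr0.
(* Otherwise [e i] could be split into [f] and [e i - f], making the family longer. *)
have primitive i f : (i < k)%N -> e i ** f = f -> f ** e i = f -> f ** f = f ->
    f != 0 -> f = e i.
  move=> ik ef fe ff f0; apply/eqP; rewrite eq_sym -subr_eq0; apply/negPn/negP.
  set g := e i - f => g0; have [ee _] := e_idem i ik.
  have fg : f ** g = 0 by rewrite rmulBr fe ff subrr.
  have gf : g ** f = 0 by rewrite rmulBl ef ff subrr.
  have gg : g ** g = g by rewrite {1}/g rmulBl fg subr0 rmulBr ee ef.
  have eg : e i ** g = g by rewrite rmulBr ee ef.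
  have ge : g ** e i = g by rewrite rmulBl ee fe.
  apply: (no_more (fun j => if j == k then g else if j == i then f else e j)).
  have orth x j : x ** e i = x -> (j < k)%N -> j != i -> x ** e j = 0.
    by move=> <- jk ji; rewrite -rmulA e_orth ?rmulr0 // eq_sym.
  have orth' x j : e i ** x = x -> (j < k)%N -> j != i -> e j ** x = 0.
    by move=> <- jk ji; rewrite rmulA e_orth ?rmul0r.
  have small j : (j < k.+1)%N -> j != k -> (j < k)%N.
    by rewrite ltnS leq_eqVlt => /orP[/eqP ->|//]; rewrite eqxx.
  split=> [j jk|j l jk lk].
    case: (eqVneq j k) => [//|/(small _ jk) {}jk]; case: (eqVneq j i) => [//|_].
    exact: e_idem.
  case: (eqVneq j k) => [->|/(small _ jk) {}jk].
    case: (eqVneq l k) => [//|/(small _ lk) {}lk _].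
    by case: (eqVneq l i) => [//|]; exact: orth.
  case: (eqVneq l k) => [-> _|/(small _ lk) {}lk jl].
    by case: (eqVneq j i) => [//|]; exact: orth'.
  case: (eqVneq j i) jl => [->|ji]; case: (eqVneq l i) => [_|li] jl //.
  - exact: orth.
  - exact: orth'.
  - exact: e_orth.
have e_pow i x : (i < k)%N -> e i ** x = x -> x ** e i = x -> x != 0 -> rpow x n = e i.
  move=> ik ex xe x0; have [ee e0] := e_idem i ik.
  have pe m : e i ** rpow x m = rpow x m.
    by elim: m => //= m IH; rewrite rmulA IH.
  have ep m : rpow x m ** e i = rpow x m.
    by case: m => //= m; rewrite -rmulA xe.
  apply: (primitive i) => //.
  have [w [ff f0]] := idempotent_in_left_ideal x0; set f := w ** x in ff f0.
  have fe : f ** e i = f by rewrite -rmulA xe.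
  have e_f : e i ** f = e i.
    apply: (primitive i) => //.
    - by rewrite rmulA ee.
    - by rewrite -rmulA fe.
    - by rewrite rmulA -[_ ** f ** e i]rmulA fe -rmulA ff.
    - apply: contraNneq f0 => ef0.
      by rewrite -ff -{1}fe -rmulA ef0 rmulr0.
  (* The power of [x] is an idempotent of the corner, so it remains to exclude 0. As
     [e i = e i ** (w ** x)], left multiplication by [x] is injective on the corner, and a vanishing
     power would descend to [x = 0]. *)
  apply: contraNneq x0 => xn0.
  elim: n xn0 => [/= ->|m IH /= xm]; first exact: eqxx.
  apply: IH; rewrite -(pe m) -e_f /f.
  have xxm : x ** rpow x m = 0 by have := rpowD x 0 m; rewrite add0n /= xm.
  by rewrite -!rmulA xxm !rmulr0.
have fin_diag i : (i < k)%N -> finite_set [set x | e i ** x = x /\ x ** e i = x].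
  move=> ik; have [ee e0] := e_idem i ik; apply: (@corner_finite _ _ n) => // x.
  exact: e_pow.
have fin i j : (i < k)%N -> (j < k)%N ->
    finite_set [set x | e i ** x = x /\ x ** e j = x].
  move=> ik jk.
  have [[x [[ex xe] x0]]|nx] := pselect (exists x, (e i ** x = x /\ x ** e j = x) /\ x != 0);
    last first.
    apply: (@sub_finite_set _ _ [set 0]) => // x xij; apply: contrapT => /eqP x0.
    by apply: nx; exists x.
  have [r xrx] : exists r, x ** r ** x <> 0.
    by apply/existsNP => h; move/eqP: x0; apply; exact: sp.
  (* A power of [y ** x] is [e j] and has [y] as left factor, so right multiplication by [y] embeds
     [e i Q e j] into [e i Q e i]. *)
  pose y := e j ** (r ** e i); have [ei _] := e_idem i ik; have [ej _] := e_idem j jk.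
  have ye : y ** e i = y by rewrite /y -!rmulA ei.
  have ey : e j ** y = y by rewrite /y rmulA ej.
  have xyx : x ** y ** x = x ** r ** x.
    by rewrite /y !rmulA xe -[_ ** e i ** x]rmulA ex.
  have yx0 : y ** x != 0.
    by apply/negP => /eqP yx; apply: xrx; rewrite -xyx -rmulA yx rmulr0.
  have yxj : rpow (y ** x) n = e j.
    by apply: e_pow => //; [rewrite rmulA ey|rewrite -rmulA xe].
  have [t yt] := rpow_mull y x n.
  apply: sub_finite_set (finite_image (fun z => z ** t) (fin_diag i ik)) => z [ez ze].
  exists (z ** y); first by split; [rewrite rmulA ez|rewrite -rmulA ye].
  by rewrite -rmulA -yt yxj.
(* Peirce decomposition: first the rows, then [Q], are sums of finitely many finite pieces. *)
have fin_row i : (i < k)%N -> finite_set [set x | e i ** x = x].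
  move=> ik; apply: sub_finite_set (finite_sumset (fun j : 'I_k => fin i j ik (ltn_ord j))).
  move=> x ex; exists (fun j : 'I_k => x ** e j) => [j|]; last by rewrite -rmul_sumr xu.
  by have [ej _] := e_idem j (ltn_ord j); split; rewrite ?rmulA ?ex // -rmulA ej.
apply: sub_finite_set (finite_sumset (fun i : 'I_k => fin_row i (ltn_ord i))) => x _.
exists (fun i : 'I_k => e i ** x) => [i|]; last by rewrite -rmul_suml ux.
by have [ei _] := e_idem i (ltn_ord i); rewrite /= rmulA ei.
Qed.

End SemiprimeFinite.

(** * Quotients by ideals *)

Section Ideals.
Context (R : rngType) (I : set R).
Hypothesis idI : is_ideal I.
Implicit Types x y : R.

Lemma idealN x : I x -> I (- x).
Proof. by move=> Ix; rewrite -sub0r; apply: idealB => //; exact: ideal0 idI. Qed.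

Lemma idealD x y : I x -> I y -> I (x + y).
Proof. by move=> Ix Iy; rewrite -(opprK y); apply: idealB => //; exact: idealN. Qed.

Lemma ideal_sum T (r : seq T) (P : pred T) (F : T -> R) :
  (forall i, P i -> I (F i)) -> I (\sum_(i <- r | P i) F i).
Proof.
by move=> IF; elim/big_rec: _ => [|i x Pi]; [exact: ideal0 idI|apply/idealD/IF].
Qed.

Lemma ideal_addr x y : I y -> I (x + y) <-> I x.
Proof.
move=> Iy; split=> [Ixy|Ix]; last exact: idealD.
by rewrite -(addrK y x); exact: idealB.
Qed.

End Ideals.

Section Quotient.
Context (R : rngType) (I : set R) (idI : is_ideal I).

(** The proof that [I] is an ideal is a parameter of the type, so that the ring structure built from
    it can be inferred. *)
Definition quot (_ : is_ideal I) : Type := {A : set R | exists x, A = ideal_coset I x}.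
Local Notation Q := (quot idI).

HB.instance Definition _ := gen_eqMixin Q.
HB.instance Definition _ := gen_choiceMixin Q.

Definition quot_pi (x : R) : Q := exist _ (ideal_coset I x) (ex_intro _ x erefl).

Lemma quot_piP x y : quot_pi x = quot_pi y <-> I (x - y).
Proof.
split=> [[xy]|Ixy].
  have : ideal_coset I x x by rewrite /ideal_coset /= subrr; exact: ideal0 idI.
  by rewrite xy.
have coset_eq : ideal_coset I x = ideal_coset I y.
  apply/seteqP; split=> z; rewrite /ideal_coset /= => Iz.
    by rewrite -(subrKA x z); apply: idealD idI _ _ Iz Ixy.
  by rewrite -(subrKA y z) -(opprB x); apply: idealB => //.
rewrite /quot_pi; move: (ex_intro _ x _) (ex_intro _ y _); rewrite coset_eq => h h'.
by rewrite (Prop_irrelevance h h').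
Qed.

Lemma quot_surj (q : Q) : exists x, q = quot_pi x.
Proof.
case: q => A h; have [x Ax] := h; exists x; subst A.
by rewrite /quot_pi (Prop_irrelevance h (ex_intro _ x erefl)).
Qed.

Definition quot_repr (q : Q) : R := projT1 (cid (quot_surj q)).

Lemma quot_reprK q : quot_pi (quot_repr q) = q.
Proof. by rewrite /quot_repr; case: cid. Qed.

Definition quot_opp (p : Q) : Q := quot_pi (- quot_repr p).
Definition quot_add (p q : Q) : Q := quot_pi (quot_repr p + quot_repr q).
Definition quot_mul (p q : Q) : Q := quot_pi (quot_repr p ** quot_repr q).

Lemma quot_repr_pi x : I (quot_repr (quot_pi x) - x).
Proof. by apply/quot_piP; rewrite quot_reprK. Qed.

Lemma quot_oppE x : quot_opp (quot_pi x) = quot_pi (- x).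
Proof. by apply/quot_piP; rewrite -opprD; apply: (idealN idI); exact: quot_repr_pi. Qed.

Lemma quot_addE x y : quot_add (quot_pi x) (quot_pi y) = quot_pi (x + y).
Proof.
apply/quot_piP; rewrite opprD addrACA.
by apply: (idealD idI); exact: quot_repr_pi.
Qed.

Lemma quot_mulE x y : quot_mul (quot_pi x) (quot_pi y) = quot_pi (x ** y).
Proof.
apply/quot_piP; set x' := quot_repr _; set y' := quot_repr _.
have -> : x' ** y' - x ** y = (x' - x) ** y' + x ** (y' - y).
  by rewrite rmulBl rmulBr addrA subrK.
by apply: (idealD idI); [apply: (idealMr idI)|apply: (idealMl idI)]; exact: quot_repr_pi.
Qed.

Lemma quot_addA : associative quot_add.
Proof.
move=> p q r; have [[x ->] [[y ->] [z ->]]] := (quot_surj p, (quot_surj q, quot_surj r)).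
by rewrite !quot_addE addrA.
Qed.
Lemma quot_addC : commutative quot_add.
Proof.
move=> p q; have [[x ->] [y ->]] := (quot_surj p, quot_surj q).
by rewrite !quot_addE addrC.
Qed.
Lemma quot_add0 : left_id (quot_pi 0) quot_add.
Proof. by move=> p; have [x ->] := quot_surj p; rewrite quot_addE add0r. Qed.
Lemma quot_addN : left_inverse (quot_pi 0) quot_opp quot_add.
Proof. by move=> p; have [x ->] := quot_surj p; rewrite quot_oppE quot_addE addNr. Qed.

HB.instance Definition _ :=
  GRing.isZmodule.Build Q quot_addA quot_addC quot_add0 quot_addN.

Lemma quot_mulA : associative quot_mul.
Proof.
move=> p q r; have [[x ->] [[y ->] [z ->]]] := (quot_surj p, (quot_surj q, quot_surj r)).
by rewrite !quot_mulE rmulA.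
Qed.
Lemma quot_mulDl : left_distributive quot_mul +%R.
Proof.
move=> p q r; have [[x ->] [[y ->] [z ->]]] := (quot_surj p, (quot_surj q, quot_surj r)).
rewrite -[quot_pi x + _]/(quot_add _ _) quot_addE !quot_mulE.
by rewrite -[RHS]/(quot_add _ _) quot_addE rmulDl.
Qed.
Lemma quot_mulDr : right_distributive quot_mul +%R.
Proof.
move=> p q r; have [[x ->] [[y ->] [z ->]]] := (quot_surj p, (quot_surj q, quot_surj r)).
rewrite -[quot_pi y + _]/(quot_add _ _) quot_addE !quot_mulE.
by rewrite -[RHS]/(quot_add _ _) quot_addE rmulDr.
Qed.

HB.instance Definition _ := Zmodule_isRng.Build Q quot_mulA quot_mulDl quot_mulDr.

Lemma quot_pi_eq0 x : quot_pi x = 0 <-> I x.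
Proof. by rewrite -[0]/(quot_pi 0) quot_piP subr0. Qed.

Lemma quot_piM x y : quot_pi x ** quot_pi y = quot_pi (x ** y).
Proof. exact: quot_mulE. Qed.

Lemma quot_piX x k : rpow (quot_pi x) k = quot_pi (rpow x k).
Proof. by elim: k => //= k ->; rewrite quot_piM. Qed.

End Quotient.

(** * Elements generating a square-zero ideal *)

Section SquareZero.
Context (R : rngType) (I : set R).
Hypothesis idI : is_ideal I.
Implicit Types (x y : R) (u : nat -> R) (s : seq R).

(** Without a unit, [x ** x] need not be of the form [x ** r ** x]; both conditions are required for
    the ideal generated by [x] to square into [I]. *)
Definition sqzero : set R := [set x | I (x ** x) /\ forall r, I (x ** r ** x)].

Lemma ideal_sqzero x : I x -> sqzero x.
Proof. by move=> Ix; split=> [|r]; apply: (idealMl idI). Qed.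

Lemma sqzero0 : sqzero 0. Proof. exact/ideal_sqzero/(ideal0 idI). Qed.

Lemma sqzeroN x : sqzero x -> sqzero (- x).
Proof.
move=> [xx xrx]; split=> [|r]; rewrite !(rmulNr, rmulrN) opprK //.
Qed.

Lemma sqzeroMl r x : sqzero x -> sqzero (r ** x).
Proof.
move=> [xx xrx]; split=> [|t].
  by rewrite -rmulA; apply: (idealMl idI); rewrite rmulA.
by rewrite -!rmulA; apply: (idealMl idI); rewrite (rmulA t) rmulA.
Qed.

Lemma sqzeroMr r x : sqzero x -> sqzero (x ** r).
Proof.
move=> [xx xrx]; split=> [|t]; rewrite rmulA; apply: (idealMr idI) => //.
by rewrite -(rmulA x).
Qed.

(* seg u a l is the product of u_a, ..., u_(a+l). *)
Fixpoint seg u a l := if l is l'.+1 then seg u a l' ** u (a + l)%N else u a.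

Lemma seg_cat u a l l' : seg u a l ** seg u (a + l).+1 l' = seg u a (l + l').+1.
Proof.
elim: l' => [|l' IH]; first by rewrite addn0 /= addnS.
rewrite addnS -[RHS]/(seg u a (l + l').+1 ** u (a + (l + l').+2)%N) -IH -rmulA /=.
by rewrite !addnS addSn addnA.
Qed.

(** The factor [u b] occurs twice in the product, so square-zero-ness applies whatever stands in
    between. *)
Lemma seg_mulr u a l b : (forall i, sqzero (u i)) -> (a <= b <= a + l)%N ->
  I (seg u a l ** u b) /\ forall r, I (seg u a l ** r ** u b).
Proof.
move=> uE; elim: l => [|l IH] /andP[ab bl] /=.
  have -> : b = a by apply/eqP; rewrite eqn_leq ab; rewrite addn0 in bl; rewrite bl.
  exact: uE.
have [->|bn] := eqVneq b (a + l.+1)%N.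
  have [uu uru] := uE (a + l.+1)%N; split=> [|r].
    by rewrite -rmulA; exact: (idealMl idI).
  by rewrite -!rmulA; apply: (idealMl idI); rewrite rmulA.
have [|_ Ir] := IH.
  by rewrite ab /= -ltnS -addnS ltn_neqAle bn.
by split=> [|r]; [exact: Ir|rewrite -(rmulA (seg u a l)); exact: Ir].
Qed.

Lemma seg_mull u a l b : (forall i, sqzero (u i)) -> (a <= b <= a + l)%N ->
  I (u b ** seg u a l).
Proof.
move=> uE; elim: l => [|l IH] /andP[ab bl] /=.
  have -> : b = a by apply/eqP; rewrite eqn_leq ab; rewrite addn0 in bl; rewrite bl.
  by have [] := uE a.
have [->|bn] := eqVneq b (a + l.+1)%N.
  by have [_ uru] := uE (a + l.+1)%N; rewrite rmulA.
rewrite rmulA; apply: (idealMr idI); apply: IH.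
by rewrite ab /= -ltnS -addnS ltn_neqAle bn.
Qed.

(** The configuration excluded by NIP, applied both to products of square-zero elements and to
    orthogonal idempotents. *)
Definition no_diagonal (k : nat) : Prop := forall x y t : nat -> R,
  ~ (forall i j, (i < k)%N -> (j < k)%N -> I (x i ** t j ** y i) <-> i <> j).

(* In x_i u_j y_i with x_i = u_0 .. u_i and y_i = u_(i+2) .. u_(k+1), the
   factor u_j occurs twice unless j = i + 1. *)
Lemma sqzero_prod k u : no_diagonal k -> (forall i, sqzero (u i)) -> I (seg u 0 k.+1).
Proof.
move=> nd uE; apply: contrapT => nI.
(* The length is chosen so that the right segment ends at index [k.+1]; the subtraction is exact as
   [i < k]. *)
apply: (nd (fun i => seg u 0 i) (fun i => seg u i.+2 (k.-1 - i)) (fun j => u j.+1)).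
move=> i j ik jk; have k_gt0 : (0 < k)%N by exact: leq_trans ik.
have ik' : (i <= k.-1)%N by rewrite -ltnS prednK.
split=> [Iij ij|/eqP ij].
  apply: nI; subst j; rewrite -[X in seg u 0 X.+1](prednK k_gt0) -[X in seg u 0 X.+2](subnKC ik').
  by have := seg_cat u 0 i.+1 (k.-1 - i); rewrite add0n addSn /= => <-.
have [ji|ij'] := ltnP j i.
  by apply: (idealMr idI); apply: (seg_mulr uE _).1; rewrite add0n ltnW.
rewrite -rmulA; apply: (idealMl idI); apply: (seg_mull uE).
have ij2 : (i < j)%N by rewrite ltn_neqAle ij.
have -> : (i.+2 + (k.-1 - i) = k.+1)%N by rewrite !addSn subnKC // prednK.
by rewrite !ltnS ij2 ltnW.
Qed.

(** Bounding the number of summands, here [k.+1], keeps each level definable. *)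
Fixpoint span k : set R :=
  if k is k'.+1 then [set x | exists y, sqzero y /\ span k' (x - y)] else sqzero.

Lemma span_ind (P : set R) : sqzero `<=` P ->
  (forall x y, P x -> P y -> P (x + y)) -> forall k, span k `<=` P.
Proof.
move=> EP PD; elim=> //= k IH x [y [Ey Sxy]].
by rewrite -(subrK y x); apply: PD; [exact: IH|exact: EP].
Qed.

Lemma span_succ k : span k `<=` span k.+1.
Proof. by move=> x Sx; exists 0; rewrite subr0; split=> //; exact: sqzero0. Qed.

Lemma span_mono i j : (i <= j)%N -> span i `<=` span j.
Proof.
move=> /subnK <-; elim: (j - i)%N => // k IH; rewrite addSn.
by apply: subset_trans IH _; exact: span_succ.
Qed.

Lemma spanD i j x y : span i x -> span j y -> span (i + j).+1 (x + y).
Proof.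
elim: j y => [|j IH] y Sx /=.
  by move=> Ey; exists y; rewrite addn0 addrK.
by move=> [z [Ez Syz]]; exists z; split=> //; rewrite -addrA addnS; exact: IH.
Qed.

(** The levels increase and each is determined by the preceding one, so one repetition makes them
    constant from [i] on. *)
Lemma span_stable i j m : (i < j)%N -> span i = span j -> span m `<=` span i.
Proof.
move=> ij eqij.
have st k : span (i + k) = span i.
  elim: k => [|k IH]; rewrite ?addn0 // addnS.
  have -> : span (i + k).+1 = span i.+1 by rewrite /= IH.
  apply/seteqP; split; last exact: span_succ.
  by rewrite [X in _ `<=` X]eqij; exact: span_mono.
by rewrite -(st m); apply: span_mono; rewrite leq_addl.
Qed.

Lemma span_ideal i j : (i < j)%N -> span i = span j -> is_ideal (span i).
Proof.
move=> ij eqij; have st m := @span_stable i j m ij eqij.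
have SN k : span k `<=` [set x | span k (- x)].
  elim: k => [|k IH] x /=; first exact: sqzeroN.
  move=> [y [Ey /IH Sxy]]; exists (- y); split; first exact: sqzeroN.
  by rewrite -opprD.
split.
- by apply: (st 0%N); exact: sqzero0.
- by move=> x y Sx Sy; exact: st (spanD Sx (SN _ _ Sy)).
- move=> r; apply: span_ind => [x Ex|x y Sx Sy].
    by apply: (st 0%N); exact: sqzeroMl.
  by rewrite rmulDr; exact: st (spanD Sx Sy).
- move=> r; apply: span_ind => [x Ex|x y Sx Sy].
    by apply: (st 0%N); exact: sqzeroMr.
  by rewrite rmulDl; exact: st (spanD Sx Sy).
Qed.

Lemma foldl_rmulA x y s : foldl rmul (x ** y) s = x ** foldl rmul y s.
Proof. by elim: s y => //= z s IH y; rewrite -rmulA IH. Qed.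

Lemma foldl_rmulD x y s :
  foldl rmul (x + y) s = foldl rmul x s + foldl rmul y s.
Proof. by elim: s x y => //= z s IH x y; rewrite rmulDl IH. Qed.

Lemma eq_seg u v a l : (forall i, (i <= a + l)%N -> u i = v i) -> seg u a l = seg v a l.
Proof.
elim: l => [|l IH] uv /=; first by rewrite uv // addn0.
by rewrite IH ?uv // => i il; apply: uv; rewrite addnS ltnW.
Qed.

Lemma foldl_seg x s : foldl rmul x s = seg (nth 0 (x :: s)) 0 (size s).
Proof.
elim/last_ind: s => //= s y IH; rewrite foldl_rcons size_rcons /= IH.
rewrite nth_rcons ltnn eqxx; congr (_ ** _); apply: eq_seg => -[|i] //=.
by rewrite add0n nth_rcons => ->.
Qed.

(** Multilinearity reduces this to products of square-zero elements. [Z j z] says that [z] followed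
    by [j] of these falls into [I], and the factors are treated one at a time. *)
Lemma span_prod k i x s : no_diagonal k -> size s = k.+1 -> span i x ->
  (forall y, y \in s -> span i y) -> I (foldl rmul x s).
Proof.
move=> nd.
pose Z j z := forall s, size s = j -> (forall y, y \in s -> sqzero y) -> I (foldl rmul z s).
have ZD j y z : Z j y -> Z j z -> Z j (y + z).
  by move=> Zy Zz s' sj sE; rewrite foldl_rmulD; apply: (idealD idI); [exact: Zy|exact: Zz].
have Zspan j z s' : Z j z -> size s' = j -> (forall y, y \in s' -> span i y) ->
    I (foldl rmul z s').
  elim: j z s' => [|j IH] z [|t s'] //= Zz; first by move=> *; exact: (Zz [::]).
  move=> [sj] sS; apply: IH => // [|y ys]; last by apply: sS; rewrite inE ys orbT.
  have : span i t by apply: sS; rewrite mem_head.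
  apply: (@span_ind [set t | Z j (z ** t)]) => [w Ew s'' sj' sE|w w']; last first.
    by rewrite /= rmulDr; exact: ZD.
  apply: (Zz (w :: s'')); rewrite /= ?sj' // => y.
  by rewrite inE => /predU1P[->|/sE].
move=> sk Sx sS; apply: Zspan sk sS.
move: Sx; apply: (@span_ind [set x | Z k.+1 x]); last by move=> y z; exact: ZD.
(* The list becomes an infinite sequence padded with 0, which is square-zero as well. *)
move=> y Ey s' sk' sE; rewrite foldl_seg sk'; apply: sqzero_prod => // j.
have [js|js] := ltnP j (size (y :: s')); last by rewrite nth_default //; exact: sqzero0.
by have := mem_nth 0 js; rewrite inE => /predU1P[->|/sE].
Qed.

(** Any [k.+2] consecutive factors multiply into [I], so [n.+1] such blocks give 0. *)
Lemma span_nilpotent k i : no_diagonal k -> nilpotent_ideal I ->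
  nilpotent_ideal (span i).
Proof.
move=> nd [n nilI].
have kill a x : (forall s, size s = a -> (forall y, y \in s -> I y) -> foldl rmul x s = 0) ->
    forall s, size s = (a * k.+2)%N -> (forall y, y \in s -> span i y) -> foldl rmul x s = 0.
  elim: a x => [|a IH] x xI s.
    by move=> /size0nil -> _; exact: (xI [::]).
  rewrite mulSn => ss sS; have k2 : (k.+2 <= size s)%N by rewrite ss leq_addr.
  rewrite -(cat_take_drop k.+2 s) foldl_cat.
  have dS y : y \in drop k.+2 s -> span i y by move/mem_drop; exact: sS.
  have tS y : y \in take k.+2 s -> span i y by move/mem_take; exact: sS.
  have sz : size (take k.+2 s) = k.+2 by rewrite size_takel.
  apply: IH => //; last by rewrite size_drop ss addKn.
  case: (take _ s) tS sz => //= t s' tS [sz] r rs rI; rewrite foldl_rmulA.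
  have It : I (foldl rmul t s').
    apply: (span_prod nd sz) => [|y ys]; apply: tS; rewrite inE ?eqxx ?ys ?orbT //.
  apply: (xI (foldl rmul t s' :: r)); first by rewrite /= rs.
  by move=> y; rewrite inE => /predU1P[->|/rI].
exists (k.+1 + n * k.+2)%N => x s ss xS.
have sk : (k.+1 <= size s)%N by rewrite ss leq_addr.
rewrite -(cat_take_drop k.+1 s) foldl_cat; apply: (kill n).
- move=> r rs rI; apply: nilI => // y; rewrite inE => /predU1P[->|/rI //].
  apply: (@span_prod _ i) nd _ _ _; rewrite ?size_takel //.
    by apply: xS; rewrite mem_head.
  by move=> z /mem_take zs; apply: xS; rewrite inE zs orbT.
- by rewrite size_drop ss addKn.
- by move=> z /mem_drop zs; apply: xS; rewrite inE zs orbT.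
Qed.

End SquareZero.

Lemma finite_repeat T (A : set T) (X : nat -> T) : finite_set A ->
  (forall k, A (X k)) -> exists i j, (i < j)%N /\ X i = X j.
Proof.
move=> fA AX; apply: contrapT => nX; apply: infinite_nat.
have X_inj : injective X.
  move=> i j Xij; apply/eqP; case: ltngtP => // ij; exfalso; apply: nX.
    by exists i, j.
  by exists j, i.
have := @finite_preimage _ _ A X (in2W X_inj) fA.
by apply: sub_finite_set => k _; exact: AX.
Qed.

(** * Definable sets and ideals in the ring *)

Section DefinableRing.
Context (L : language) (R : rngType) (E : interpretation L R).
Local Notation M := (ring_structure E).
Local Notation dfun := (@definable_fun (ring_language L) M).
Local Notation dset := (@definable (ring_language L) M).

Lemma dfun_zero V : dfun (fun _ : V -> R => 0).
Proof.
exists (@App (ring_language L) V (inl OpZero) (fun i : 'I_0 => match i with Ordinal _ h => match notF h with end end)).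
by [].
Qed.

Definition pair_ord T (x y : T) (i : 'I_2) : T := if i == ord0 then x else y.

Lemma dfun_add V (f g : (V -> R) -> R) : dfun f -> dfun g -> dfun (fun e => f e + g e).
Proof.
move=> [t tP] [u uP].
exists (@App (ring_language L) V (inl OpAdd) (pair_ord t u)) => e /=.
by rewrite /pair_ord /= tP uP.
Qed.

Lemma dfun_opp V (f : (V -> R) -> R) : dfun f -> dfun (fun e => - f e).
Proof.
move=> [t tP]; exists (@App (ring_language L) V (inl OpOpp) (fun=> t)) => e /=.
by rewrite tP.
Qed.

Lemma dfun_mul V (f g : (V -> R) -> R) : dfun f -> dfun g -> dfun (fun e => f e ** g e).
Proof.
move=> [t tP] [u uP].
exists (@App (ring_language L) V (inl OpMul) (pair_ord t u)) => e /=.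
by rewrite /pair_ord /= tP uP.
Qed.

Lemma dfun_pow V (f : (V -> R) -> R) k : dfun f -> dfun (fun e => rpow (f e) k).
Proof. by move=> df; elim: k => [|k IH] //=; exact: dfun_mul. Qed.

Lemma dfun_var V (v : V) : dfun (fun e => e v).
Proof. exact: definable_fun_var. Qed.

Definition definable1 (S : set R) : Prop := dset [set e : 'I_1 -> R | S (e ord0)].

Lemma definable1_fun V S (f : (V -> R) -> R) :
  definable1 S -> dfun f -> dset [set e | S (f e)].
Proof.
move=> dS df.
have d1 : dset [set e : option V -> R | S (e None)].
  exact: (definable_rename (fun _ : 'I_1 => None) dS).
have d2 : dset [set e : option V -> R | e None = f (e \o Some)].
  by apply: definable_eq; [exact: dfun_var|exact: definable_fun_rename].
have := definable_exists (definable_and d1 d2); apply: definable_ext => e /=.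
have es x : env_cons x e \o Some = e by apply/funext.
by split=> [[x]|Sf]; [rewrite es => -[] /[swap] ->|exists (f e); rewrite es].
Qed.

Lemma definable1_sqzero I : definable1 I -> definable1 (sqzero I).
Proof.
move=> dI; apply: definable_and.
  by apply: definable1_fun => //; apply: dfun_mul; exact: dfun_var.
have : dset [set e : option 'I_1 -> R | I (e (Some ord0) ** e None ** e (Some ord0))].
  by apply: definable1_fun => //; do ?apply: dfun_mul; exact: dfun_var.
exact: definable_forall.
Qed.

Lemma definable1_span I k : definable1 I -> definable1 (span I k).
Proof.
move=> dI; elim: k => [|k IH]; first exact: definable1_sqzero.
have d1 : dset [set e : option 'I_1 -> R | sqzero I (e None)].
  by apply: definable1_fun; [exact: definable1_sqzero|exact: dfun_var].
have d2 : dset [set e : option 'I_1 -> R | span I k (e (Some ord0) - e None)].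
  by apply: definable1_fun => //; apply: dfun_add; [|apply: dfun_opp]; exact: dfun_var.
exact: (definable_exists (definable_and d1 d2)).
Qed.

Hypothesis nip : NIP (Th M).

(* The sums of subfamilies of t are the parameters shattering the pairs
   (x_i, y_i). *)
Lemma definable_no_diagonal I : is_ideal I -> definable1 I ->
  exists k, no_diagonal I k.
Proof.
move=> idI dI.
have dX : dset [set e : 'I_2 + 'I_1 -> R |
    ~ I (e (inl ord0) ** e (inr ord0) ** e (inl ord_max))].
  apply: definable_setC; apply: definable1_fun => //.
  by do ?apply: dfun_mul; exact: dfun_var.
have [k nk] := NIP_finite nip dX; exists k => x y t xty; apply: nk.
exists (fun i => pair_ord (x i) (y i)) => w.
exists (fun=> \sum_(j < k | `[< w j >]) t j) => i ik /=.
rewrite rmul_sumr rmul_suml.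
have off (j : 'I_k) : j != Ordinal ik -> I (x i ** t j ** y i).
  by move=> ji; apply/xty => // ij; case/eqP: ji; apply: val_inj.
split=> [nI|wi Isum].
  apply: contrapT => nwi; apply: nI; apply: (ideal_sum idI) => j /asboolP wj.
  by apply: off; apply/eqP => ji; apply: nwi; move: wj; rewrite ji.
have /(xty _ _ ik ik) : I (x i ** t i ** y i) => //.
move: Isum; rewrite (bigD1 (Ordinal ik)) /=; last exact/asboolP.
by move/(ideal_addr idI); apply; apply: (ideal_sum idI) => j /andP[_]; exact: off.
Qed.

Hypothesis fin : forall n, finite_set [set X : set ('I_n.+1 -> M) | definable X].

Lemma definable1_repeat (X : nat -> set R) : (forall k, definable1 (X k)) ->
  exists i j, (i < j)%N /\ X i = X j.
Proof.
move=> dX; have [i [j [ij eqX]]] := finite_repeat (fin 0) dX.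
exists i, j; split=> //; apply/seteqP.
by split=> x Xx; have := congr1 (fun A => A (fun=> x)) eqX => /=;
  [move=> <-|move=> ->].
Qed.

(** Otherwise each definable nilpotent ideal is strictly contained in the stable level of its spans,
    again definable and nilpotent. Iterating from 0 gives infinitely many definable sets. *)
Lemma maximal_nilpotent_ideal : exists I : set R,
  [/\ is_ideal I, definable1 I, nilpotent_ideal I & sqzero I `<=` I].
Proof.
apply: contrapT => nmax.
pose P I := [/\ is_ideal I, definable1 I & nilpotent_ideal I].
pose C := {I : set R | P I}.
have /choice[next nextP] (I : C) : exists J : C,
    proj1_sig I `<=` proj1_sig J /\ ~ (proj1_sig J `<=` proj1_sig I).
  case: I => I [idI dI nI] /=.
  have [x [Ex nIx]] : exists x, sqzero I x /\ ~ I x.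
    apply: contrapT => nx; apply: nmax; exists I; split=> // x Ex.
    by apply: contrapT => nIx; apply: nx; exists x.
  have [k nd] := definable_no_diagonal idI dI.
  have [i [j [ij eqS]]] := definable1_repeat (fun k => definable1_span k dI).
  have JP : P (span I i).
    split; [exact: span_ideal idI _ _ ij eqS|exact: definable1_span|].
    exact: (span_nilpotent idI _ nd).
  have ES : sqzero I `<=` span I i by exact: (span_mono idI (leq0n i)).
  exists (exist P _ JP); split=> /= [y Iy|/(_ x (ES x Ex))//].
  exact/ES/(ideal_sqzero idI).
have C0 : P [set 0].
  split.
  - split=> // [x y -> ->|r x ->|r x ->] /=; first by rewrite subr0.
      by rewrite rmulr0.
    by rewrite rmul0r.
  - by apply: definable_eq; [exact: dfun_var|exact: dfun_zero].
  - by exists 0%N => r s /size0nil -> /(_ r (mem_head _ _)).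
pose X := fix X k : C := if k is k'.+1 then next (X k') else exist P _ C0.
have Xmono i j : (i <= j)%N -> proj1_sig (X i) `<=` proj1_sig (X j).
  move=> /subnK <-; elim: (j - i)%N => // k IH; rewrite addSn /=.
  by apply: subset_trans IH _; exact: (nextP _).1.
have [|i [j [ij eqX]]] := @definable1_repeat (fun k => proj1_sig (X k)).
  by move=> k; have [] := proj2_sig (X k).
by apply: (nextP (X i)).2; rewrite [X in _ `<=` X]eqX; exact: (Xmono i.+1 j).
Qed.

(** The graphs of the power maps are definable sets of pairs, so two of them coincide. *)
Lemma power_idempotent : exists n, forall x : R, rpow x n ** rpow x n = rpow x n.
Proof.
pose X k := [set e : 'I_2 -> R | e ord_max = rpow (e ord0) k].
have dX k : dset (X k).
  by apply: definable_eq; [|apply: dfun_pow]; exact: dfun_var.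
have [i [j [ij eqX]]] := finite_repeat (fin 1) dX.
apply: (rpow_idempotent ij) => x.
have : X i (pair_ord x (rpow x i)) by [].
by rewrite eqX.
Qed.

Lemma definable_nilpotent_by_finite : nilpotent_by_finite R.
Proof.
have [I [idI dI nI EI]] := maximal_nilpotent_ideal.
exists I; split=> //; suff finQ : finite_set [set: quot idI].
  have := finite_image (fun q : quot idI => proj1_sig q) finQ.
  by apply: sub_finite_set => A [x _ <-]; exists (quot_pi idI x).
have [n pow_n] := power_idempotent; have [k nd] := definable_no_diagonal idI dI.
apply: (@semiprime_finite _ n k).
- move=> q; have [x ->] := quot_surj q => xrx.
  have Ixrx r : I (x ** r ** x).
    by apply/(quot_pi_eq0 idI); rewrite -!quot_piM; exact: xrx.
  apply/quot_pi_eq0/EI; split=> //.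
  (* It remains to see that [x ** x] is in [I], which the hypothesis on [x ** r ** x] does not
     contain; but [x ** x] is itself square-zero modulo [I]. *)
  apply: EI; split=> [|r]; rewrite !rmulA.
    by apply: (idealMr idI); exact: Ixrx.
  by apply: (idealMr idI); rewrite -(rmulA x x r); exact: Ixrx.
- by move=> q; have [x ->] := quot_surj q; rewrite quot_piX quot_piM pow_n.
- move=> [e [e_idem e_orth]].
  pose x i := quot_repr (e i).
  (* For orthogonal idempotents [e i ** e j ** e i] vanishes exactly off the diagonal, so [k] of
     them would form the excluded configuration. *)
  apply: (nd x x x) => i j ik jk; rewrite -(quot_pi_eq0 idI) -!quot_piM !quot_reprK.
  have [ee e0] := e_idem i ik; split=> [+ ij|/eqP ij].
    by rewrite -ij ee ee; move/eqP; rewrite (negPf e0).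
  by rewrite e_orth // rmul0r.
Qed.

End DefinableRing.

Theorem theorem3p1 (L : language) (R : rngType) (E : interpretation L R) :
  countable_language (ring_language L) ->
  omega_categorical (ring_structure E) ->
  NIP (Th (ring_structure E)) ->
  nilpotent_by_finite R.
Proof.
move=> cL cat nip; apply: (definable_nilpotent_by_finite nip) => n.
exact: ryll_nardzewski.
Qed.
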